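(* Let $d\in\mathbb{N}$ and $0<\eta<1/d$. If $d=1$ then $\mathcal{D}(\eta)^c=K_1^c=\mathbb{Q}$. If $d\ge 2$ then \[\dim_H(\mathcal{D}(\eta)^c\setminus K_d^c)\ge \frac{d}{1+1/\eta}\] and \[\dim_H(\mathcal{D}(\eta)^c\setminus K_d^c)\le d-2+\frac{2(d+1)((1+\eta)d-1)}{(1+\eta)d^2}.\]
   Context: For $\boldsymbol{\alpha}\in\mathbb{R}^d$ and $\eta\in\mathbb{R}$, let $\mathrm{NA}_\eta(\boldsymbol{\alpha})=\{|q|^{\eta}(q\boldsymbol{\alpha}-\boldsymbol{p}):q\in\mathbb{Z}\setminus\{0\},\ \boldsymbol{p}\in\mathbb{Z}^d\}$ and let $\mathcal{A}_\eta(\boldsymbol{\alpha})$ be the set of accumulation points of $\mathrm{NA}_\eta(\boldsymbol{\alpha})$. Define $\mathcal{D}(\eta)=\{\boldsymbol{\alpha}\in\mathbb{R}^d:\mathcal{A}_\eta(\boldsymbol{\alpha})=\mathbb{R}^d\}$ with complement $\mathcal{D}(\eta)^c$ in $\mathbb{R}^d$. $K_d$ denotes the set of $\boldsymbol{\alpha}=(\alpha_1,\dots,\alpha_d)\in\mathbb{R}^d$ such that $1,\alpha_1,\ldots,\alpha_d$ are linearly independent over $\mathbb{Q}$, and $K_d^c=\mathbb{R}^d\setminus K_d$. $\dim_H$ denotes Hausdorff dimension. *)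

(* Defs.v *)
From HB Require Import structures.
From mathcomp Require Import all_boot all_order all_algebra.
From mathcomp Require Import all_classical all_reals all_analysis.
Set Implicit Arguments. Unset Strict Implicit. Unset Printing Implicit Defensive.
Import Order.TTheory GRing.Theory Num.Theory.
Local Open Scope classical_set_scope.
Local Open Scope ring_scope.

Section Defs.
Variable R : realType.

Definition edist (d : nat) (x y : 'rV[R]_d) : R :=
  Num.sqrt (\sum_(i < d) (x ord0 i - y ord0 i) ^+ 2).

Definition NA (d : nat) (eta : R) (a : 'rV[R]_d) : set 'rV[R]_d :=
  [set y | exists (q : int) (p : 'rV[int]_d), q != 0 /\
     y = ((`|q|%:~R : R) `^ eta) *: (q%:~R *: a - map_mx (fun z : int => z%:~R) p)].

Definition accum (d : nat) (S : set 'rV[R]_d) : set 'rV[R]_d :=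
  [set y | forall e : R, 0 < e -> exists z, S z /\ z != y /\ edist z y < e].

Definition Dset (d : nat) (eta : R) : set 'rV[R]_d :=
  [set a | accum (NA eta a) = setT].

Definition Kset (d : nat) : set 'rV[R]_d :=
  [set a | forall (c0 : rat) (c : 'I_d -> rat),
     ratr c0 + \sum_(i < d) ratr (c i) * a ord0 i = 0 ->
     c0 = 0 /\ forall i, c i = 0].

Definition Qset1 : set 'rV[R]_1 := [set a | exists q : rat, a ord0 ord0 = ratr q].

Definition ediam (d : nat) (A : set 'rV[R]_d) : \bar R :=
  ereal_sup [set (edist x y)%:E | x in A & y in A].

Definition hcontrib (d : nat) (s : R) (A : set 'rV[R]_d) : \bar R :=
  if `[< A = set0 >] then 0%E else ((fine (ediam A)) `^ s)%:E.

Definition hcontent (d : nat) (delta s : R) (A : set 'rV[R]_d) : \bar R :=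
  ereal_inf [set (\sum_(0 <= n <oo) hcontrib s (F n))%E
            | F in [set F : nat -> set 'rV[R]_d |
                     A `<=` \bigcup_n F n /\ forall n, (ediam (F n) <= delta%:E)%E]].

Definition hmeasure (d : nat) (s : R) (A : set 'rV[R]_d) : \bar R :=
  ereal_sup [set hcontent delta s A | delta in [set delta : R | 0 < delta]].

Definition hdim (d : nat) (A : set 'rV[R]_d) : \bar R :=
  ereal_inf [set s%:E | s in [set s : R | 0 <= s /\ hmeasure s A = 0%E]].

End Defs.

(* Main.v *)
Require Import Defs.
From HB Require Import structures.
From mathcomp Require Import all_boot all_order all_algebra.
From mathcomp Require Import all_classical all_reals all_analysis.
From mathcomp Require Import ring lra zify.
Set Implicit Arguments. Unset Strict Implicit. Unset Printing Implicit Defensive.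
Import Order.TTheory GRing.Theory Num.Theory.
Local Open Scope classical_set_scope.
Local Open Scope ring_scope.

(* Put w = 1/eta. By definition alpha lies outside D(eta) iff some ball contains no point of
   NA_eta(alpha) ("hole" below).

   Upper bound. A hole says that the lattice of the points (q, q alpha - p), suitably rescaled,
   has large covering radius for every scale Q; by transference (covering radius times dual
   minimum is bounded) there is for every Q a nonzero integer vector (n, m) with
   |n + m.alpha| <= C / Q and |m| <= C Q^eta. In dimension one these vectors must become
   proportional, so alpha is rational. In dimension d >= 2, alpha in K_d lies in infinitely many
   slabs |n + m.alpha| <= |m|^(-w'), w' < w; covering the slabs gives dimension at most
   d - (1 - d eta)/(1 + eta), which is below the stated bound because d^2 > 2.

   Lower bound. For d = 2, let x be approximable to order 1 + w', w' > w, by rationals z_k with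
   rapidly growing denominators b_k, and y = sum (x - z_k)/H_k with H_k = b_0 ... b_(k-1). Then (x, y)
   is extremely close to the rational lines given by the partial sums, whose slopes stay
   bounded, which forces a hole at (0, 1/4). By Jarnik-Besicovitch the admissible x have dimension
   2/(1 + w'). For d >= 3 the bound is less than 1, and one adds coordinates to a point of lower
   dimension, avoiding countably many values each time. *)

(** [hdim] is an infimum over the [s] of measure zero, so one such [s] gives the upper bound, and
    nonvanishing for every smaller [s] gives the lower one. Transference is needed only up to a
    constant depending on the dimension, which an induction by orthogonal projection provides.
    Jarnik-Besicovitch is proved as an avoidance statement: nested segments with rational left
    endpoints escape every cover of small total size and also a prescribed sequence of points. Hence
    one construction serves both the planar case and the added coordinates, after projecting a cover
    to one coordinate. Why rational lines make a hole: let [H y = S x + T] be the last of them with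
    [H <= t = |q|^eta], and [v = t (q a - p)]. Up to a small error, [H v_2 - S v_1] is [t] times the
    integer [q T - H p_2 + S p_1]. For [v] near (0, 1/4) and [S <= 2 H] it is near [H / 4], strictly
    between 0 and [t], which is impossible. *)

Local Notation edist := Defs.edist.

(** * Transference: covering radius against the minimum of a form *)

Definition dot {R : pzRingType} {n : nat} (u v : 'rV[R]_n) : R := (u *m v^T) 0 0.

Lemma dotE {R : pzRingType} {n} (u v : 'rV[R]_n) : dot u v = \sum_i u 0 i * v 0 i.
Proof. by rewrite /dot mxE; apply: eq_bigr => i _; rewrite mxE. Qed.

Lemma dotvv_ge0 {R : realDomainType} {n} (u : 'rV[R]_n) : 0 <= dot u u.
Proof. by rewrite dotE sumr_ge0 // => i _; rewrite -expr2 sqr_ge0. Qed.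

Lemma dotZ {R : comPzRingType} {n} (a : R) (u : 'rV[R]_n) : dot (a *: u) (a *: u) = a ^+ 2 * dot u u.
Proof. by rewrite !dotE mulr_sumr; apply: eq_bigr => i _; rewrite !mxE; ring. Qed.

Lemma dotZD {R : comPzRingType} {n} (a : R) (u v : 'rV[R]_n) :
  dot (a *: u + v) (a *: u + v) = a ^+ 2 * dot u u + dot v v + (2 * a) * dot v u.
Proof.
rewrite !dotE !mulr_sumr -!big_split; apply: eq_bigr => i _ /=; rewrite !mxE; ring.
Qed.

Lemma round_int (R : realType) (x : R) : exists k : int, `|x - k%:~R| <= 1 / 2.
Proof.
exists (Num.floor (x + 1 / 2)).
have := floor_le (x + 1/2); have := floorD1_gt (x + 1/2).
rewrite intrD => h1 h2; rewrite ler_norml; apply/andP; split; lra.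
Qed.

Lemma sqr_sum_le (R : realFieldType) (a b X Y P e : R) : 0 <= a -> 0 <= b -> 0 <= X -> 0 <= Y ->
  P ^+ 2 <= a * X -> e ^+ 2 <= b * Y -> (P + e) ^+ 2 <= (a + b) * (X + Y).
Proof.
move=> a0 b0 X0 Y0 hP he.
have h : 2 * (P * e) <= a * Y + b * X.
  have Z0 : 0 <= a * Y + b * X by rewrite addr_ge0 ?mulr_ge0.
  apply: le_trans (ler_norm _) _.
  rewrite -(@ler_pXn2r _ 2) // ?nnegrE //.
  have -> : `|2 * (P * e)| ^+ 2 = 4 * (P ^+ 2 * e ^+ 2).
    by rewrite real_normK ?num_real //; ring.
  apply: (@le_trans _ _ (4 * ((a * X) * (b * Y)))).
    by rewrite ler_wpM2l // ler_pM // sqr_ge0.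
  have := sqr_ge0 (a * Y - b * X); nra.
nra.
Qed.

(** The squared covering radius of Z^n for the dual of the form [|z M|^2] is at most [T] over the
    minimum [lam]. Testing against every [z] expresses the dual form without inverting [M], and
    leaving [N] free lets the rows be projected inside the same space. *)
Definition covers (R : realType) (n : nat) (T : R) := forall N (M : 'M[R]_(n, N)) (lam : R),
  0 < lam ->
  (forall m : 'rV[int]_n, m != 0 ->
    lam <= dot (map_mx intr m *m M) (map_mx intr m *m M)) ->
  forall x : 'rV[R]_n, exists k : 'rV[int]_n, forall z : 'rV[R]_n,
    dot (x - map_mx intr k) z ^+ 2 <= T / lam * dot (z *m M) (z *m M).

(** Project the rows orthogonally to the first row [v]. Rounding the coefficient along [v] to at
    most 1/2 costs at most [5/16 * lam], so the projected form keeps a minimum of at least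
    [lam / 2]; this is why [v] must be nearly shortest. Rounding the first coordinate of [x] leaves
    a problem in dimension [n], and Cauchy-Schwarz adds the two errors. *)
Lemma covers_step (R : realType) n (T : R) : 0 <= T -> covers n T ->
  forall N (M : 'M[R]_(1 + n, N)) (lam : R), 0 < lam ->
  (forall m : 'rV[int]_(1 + n), m != 0 ->
    lam <= dot (map_mx intr m *m M) (map_mx intr m *m M)) ->
  dot (usubmx M) (usubmx M) <= 5 / 4 * lam ->
  forall x : 'rV[R]_(1 + n), exists k : 'rV[int]_(1 + n), forall z : 'rV[R]_(1 + n),
    dot (x - map_mx intr k) z ^+ 2 <= (1 + 2 * T) / lam * dot (z *m M) (z *m M).
Proof.
move=> T0 IH N M lam lam0 hM hv x.
set v := usubmx M in hv; set g := dot v v in hv.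
set M1 := dsubmx M.
have gl : lam <= g.
  have := hM (row_mx 1%:M 0).
  have -> : map_mx intr (row_mx 1%:M 0 : 'rV[int]_(1 + n)) *m M = v.
    by rewrite map_row_mx map_mx0 map_scalar_mx rmorph1 -{1}[M]vsubmxK mul_row_col mul0mx addr0 mul1mx.
  apply; apply/eqP => /(congr1 (fun m : 'rV[int]_(1 + n) => m 0 (lshift n 0))).
  by rewrite row_mxEl !mxE eqxx.
have g0 : 0 < g by exact: lt_le_trans gl.
pose c : 'cV[R]_n := g^-1 *: (M1 *m v^T).
pose M' := M1 - c *m v.
have gE : v *m v^T = g%:M by rewrite [LHS]mx11_scalar.
have M'v : M' *m v^T = 0.
  by rewrite mulmxBl -mulmxA gE mul_mx_scalar scalerA mulfV ?gt_eqF // scale1r subrr.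
have decE (z : 'rV[R]_(1 + n)) : dot (z *m M) (z *m M) =
   (lsubmx z 0 0 + (rsubmx z *m c) 0 0) ^+ 2 * g + dot (rsubmx z *m M') (rsubmx z *m M').
  set t := (X in X ^+ 2 * g).
  have -> : z *m M = t *: v + rsubmx z *m M'.
    rewrite -{1}[z]hsubmxK -{1}[M]vsubmxK mul_row_col -/v -/M1 /M' mulmxBr mulmxA.
    rewrite {1}[lsubmx z]mx11_scalar [rsubmx z *m c]mx11_scalar !mul_scalar_mx /t scalerDl.
    by rewrite -[X in _ = X]addrA; congr (_ + _); rewrite addrCA subrr addr0.
  have vM' : dot (rsubmx z *m M') v = 0.
    by rewrite /dot -mulmxA M'v mulmx0 mxE.
  by rewrite dotZD vM' mulr0 addr0.
have l2 : 0 < lam / 2 by rewrite divr_gt0.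
have hM' (m : 'rV[int]_n) : m != 0 ->
    lam / 2 <= dot (map_mx intr m *m M') (map_mx intr m *m M').
  move=> m0.
  have [j hj] := round_int (- (map_mx intr m *m c) 0 0).
  have := hM (row_mx j%:M m).
  rewrite map_row_mx map_scalar_mx decE row_mxKl row_mxKr [(j%:~R%:M) 0 0]mxE eqxx mulr1n.
  have -> : row_mx j%:M m != 0.
    apply/eqP => e; move/eqP: m0; apply.
    by rewrite -[m](row_mxKr (j%:M : 'M[int]_1)) e linear0.
  move=> /(_ isT) /= h.
  have : (j%:~R + (map_mx intr m *m c) 0 0) ^+ 2 <= 1 / 4.
    have : `|j%:~R + (map_mx intr m *m c) 0 0| <= 1 / 2.
      by rewrite -normrN opprD addrC.
    rewrite ler_norml => /andP[h1 h2]; nra.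
  move: h hv gl g0 l2; set E := dot _ _; set q := _ ^+ 2; nra.
have [k1 hk1] := round_int (lsubmx x 0 0).
(* The shift by a multiple of [c^T] makes the pairing split as [u * t + e], since [t] contains
   [rsubmx z *m c]. *)
have [k' hk'] := IH N M' (lam / 2) l2 hM' (rsubmx x - (lsubmx x 0 0 - k1%:~R) *: c^T).
exists (row_mx k1%:M k') => z.
rewrite decE.
set t := (X in X ^+ 2 * g); set u := lsubmx x 0 0 - k1%:~R in hk1 hk'.
set e := dot (rsubmx x - u *: c^T - map_mx intr k') (rsubmx z).
have -> : dot (x - map_mx intr (row_mx k1%:M k')) z = u * t + e.
  rewrite /dot map_row_mx map_scalar_mx -{1}[x]hsubmxK opp_row_mx add_row_mx.
  rewrite -{1}[z]hsubmxK tr_row_mx mul_row_col /e /dot.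
  have -> : lsubmx x - k1%:~R%:M = u%:M.
    by rewrite {1}[lsubmx x]mx11_scalar -raddfB.
  rewrite mul_scalar_mx !mulmxBl -scalemxAl.
  have -> : c^T *m (rsubmx z)^T = (rsubmx z *m c)^T by rewrite trmx_mul.
  rewrite /t !mxE; ring.
have -> : (1 + 2 * T) / lam = 1 / lam + T / (lam / 2).
  by field; rewrite gt_eqF.
apply: sqr_sum_le.
- by rewrite divr_ge0 // ltW.
- by rewrite divr_ge0 // ltW.
- by rewrite mulr_ge0 ?sqr_ge0 // ltW.
- exact: dotvv_ge0.
- have -> : 1 / lam * (t ^+ 2 * g) = (lam^-1 * g) * t ^+ 2 by ring.
  rewrite exprMn; apply: ler_wpM2r; first exact: sqr_ge0.
  have : u ^+ 2 <= 1 / 4 by move: hk1; rewrite ler_norml => /andP[? ?]; nra.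
  move=> h; apply: (@le_trans _ _ 1); first by lra.
  by rewrite ler_pdivlMl // mulr1.
- exact: hk'.
Qed.

(** A vector within a factor 5/4 of the infimum of the form is enough, so attainment of the minimum
    is not at issue. Its primitive part is no longer and extends to a basis of Z^(1+n), in which
    [covers_step] applies. *)
Lemma covering (R : realType) n : exists2 T : R, 0 <= T & covers n T.
Proof.
elim: n => [|n [T T0 IH]].
  exists 0 => // N M lam lam0 _ x; exists 0 => z.
  by rewrite dotE big_ord0 expr0n /= mulr_ge0 ?dotvv_ge0 // divr_ge0 // ltW.
exists (1 + 2 * T); first by rewrite addr_ge0 // mulr_ge0.
move=> N M lam lam0 hM x.
pose f (m : 'rV[int]_(1 + n)) : R := dot (map_mx intr m *m M) (map_mx intr m *m M).
pose S := [set f m | m in [set m | m != 0]].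
have S0 : has_inf S.
  split; last by exists lam => _ [m m0 <-]; exact: hM.
  exists (f (row_mx 1%:M 0)), (row_mx 1%:M 0) => //=.
  apply/eqP => /(congr1 (fun m : 'rV[int]_(1 + n) => m 0 (lshift n 0))).
  by rewrite row_mxEl !mxE eqxx.
have lS : lam <= inf S.
  by apply: lb_le_inf => [|_ [m m0 <-]]; [exact: S0.1|exact: hM].
have S1 : 0 < inf S by exact: lt_le_trans lS.
have hS (m : 'rV[int]_(1 + n)) : m != 0 -> inf S <= f m.
  by move=> m0; apply: ge_inf; [exact: S0.2|exists m].
have [_ [m m0 <-] hm] : exists2 y, S y & y < inf S + inf S / 4.
  by apply: inf_adherent => //; rewrite divr_gt0.
(* In the Smith form of the one-row matrix [m] the diagonal factor has a single nonzero column at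
   most, so [m] is a multiple of the first row of the unimodular [U]. *)
have [L _ [U Uu [d _ mE]]] := int_Smith_normal_form m.
set D := (\matrix_(i, j) _) in mE.
pose a := L 0 0 * d`_0.
have {}mE : m = a *: usubmx (U : 'M[int]_(1 + n)).
  rewrite mE; apply/rowP => j; rewrite !mxE (bigD1 ord0) //= big1 ?addr0.
    rewrite !mxE big_ord1 !mxE /= mulr1n; congr (_ * U _ _); exact/val_inj.
  move=> i i0; rewrite !mxE big_ord1 !mxE eq_sym.
  by rewrite (_ : (i == 0%N :> nat) = false) ?mulr0n ?mulr0 ?mul0r //; exact: negbTE.
have a0 : a != 0 by apply: contraNneq m0 => a0; rewrite mE a0 scale0r.
have hU : f (usubmx (U : 'M[int]_(1 + n))) <= f m.
  rewrite /f mE map_mxZ -scalemxAl dotZ ler_peMl ?dotvv_ge0 //.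
  by rewrite -rmorphXn /= ler1z -gtz0_ge1 exprn_even_gt0.
pose V := map_mx intr (U : 'M[int]_(1 + n)) : 'M[R]_(1 + n).
have h1 (k : 'rV[int]_(1 + n)) : k != 0 ->
    inf S <= dot (map_mx intr k *m (V *m M)) (map_mx intr k *m (V *m M)).
  move=> k0; rewrite mulmxA -map_mxM; apply: hS.
  by apply: contraNneq k0 => h; rewrite -[k](mulmxK Uu) h mul0mx.
have h2 : dot (usubmx (V *m M)) (usubmx (V *m M)) <= 5 / 4 * inf S.
  have -> : usubmx (V *m M) = map_mx intr (usubmx (U : 'M[int]_(1 + n))) *m M.
    by rewrite -mul_usub_mx map_usubmx.
  by apply: le_trans hU _; apply: ltW; apply: lt_le_trans hm _; lra.
have [k hk] := covers_step T0 IH S1 h1 h2 (x *m V^T).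
exists (k *m (invmx U)^T) => z.
have VV : V *m map_mx intr (invmx (U : 'M[int]_(1 + n))) = 1%:M.
  by rewrite -map_mxM mulmxV // map_scalar_mx rmorph1.
have VV' : map_mx intr (invmx (U : 'M[int]_(1 + n))) *m V = 1%:M.
  by rewrite -map_mxM mulVmx // map_scalar_mx rmorph1.
pose z' := z *m map_mx intr (invmx (U : 'M[int]_(1 + n))).
have zE : z = z' *m V by rewrite /z' -mulmxA VV' mulmx1.
have -> : dot (x - map_mx intr (k *m (invmx U)^T)) z = dot (x *m V^T - map_mx intr k) z'.
  rewrite /dot map_mxM [in LHS]zE trmx_mul mulmxA mulmxBl -[_ *m _ *m V^T]mulmxA.
  by rewrite -map_trmx -trmx_mul VV trmx1 mulmx1.
apply: le_trans (hk z') _.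
rewrite mulmxA -zE ler_wpM2r ?dotvv_ge0 // ler_wpM2l ?lef_pV2 //.
by rewrite addr_ge0 // mulr_ge0.
Qed.

(** * Holes and the failure of density *)

Section Distance.
Variables (R : realType) (d : nat).
Implicit Types x y : 'rV[R]_d.

Lemma coord_le_edist x y i : `|x ord0 i - y ord0 i| <= edist x y.
Proof.
rewrite -sqrtr_sqr ler_wsqrtr // (bigD1 i) //= lerDl sumr_ge0 // => j _.
exact: sqr_ge0.
Qed.

Lemma edist_le_sum x y : edist x y <= \sum_i `|x ord0 i - y ord0 i|.
Proof.
have S0 : 0 <= \sum_i `|x ord0 i - y ord0 i| by rewrite sumr_ge0.
rewrite -[leRHS](ger0_norm S0) -sqrtr_sqr ler_wsqrtr // expr2 mulr_suml.
apply: ler_sum => i _; rewrite -real_normK ?num_real // expr2 ler_wpM2l //.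
by rewrite (bigD1 i) //= lerDl sumr_ge0.
Qed.

Lemma edist_le x y (e : R) : (forall i, `|x ord0 i - y ord0 i| <= e) -> edist x y <= d%:R * e.
Proof.
move=> h; apply: le_trans (edist_le_sum _ _) _.
apply: (@le_trans _ _ (\sum_(i < d) e)); first exact: ler_sum.
by rewrite sumr_const card_ord mulr_natl.
Qed.

End Distance.

(** The empty ball is taken in the sup norm: one bad coordinate suffices, which lets a hole survive
    the addition of coordinates. *)
Definition hole (R : realType) (d : nat) (eta : R) (a : 'rV[R]_d) :=
  exists (y : 'rV[R]_d) (e : R), 0 < e /\
    forall (q : int) (p : 'rV[int]_d), q != 0 ->
    exists i, e <= `| (`|q|%:~R : R) `^ eta * (q%:~R * a ord0 i - (p ord0 i)%:~R) - y ord0 i|.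

Lemma hole_notin_Dset (R : realType) (d : nat) (eta : R) (a : 'rV[R]_d) :
  hole eta a -> ~ Dset eta a.
Proof.
move=> [y [e [e0 h]]] aD.
have : accum (NA eta a) y by rewrite aD.
move=> /(_ e e0)[z [[q [p [q0 ->]]] [_ hz]]].
have [i hi] := h q p q0.
have := le_lt_trans (coord_le_edist _ _ i) hz.
by rewrite !mxE ltNge hi.
Qed.

(** Accumulation ignores [y] itself, which may lie in [NA eta a]. The centre is therefore moved by
    [2 * f] in every coordinate: the box of radius [f] there misses [y] and stays within distance
    [e] of it. *)
Lemma notin_Dset_hole (R : realType) (d : nat) (eta : R) (a : 'rV[R]_d) : (0 < d)%N ->
  ~ Dset eta a -> hole eta a.
Proof.
move=> d0 aD.
have [y hy] : exists y, ~ accum (NA eta a) y.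
  apply: contrapT => h; apply: aD; apply/seteqP; split => // y _.
  by apply: contrapT => hy; apply: h; exists y.
have [e [e0 he]] : exists e, 0 < e /\ forall z, NA eta a z -> z != y -> e <= edist z y.
  apply: contrapT => h; apply: hy => e e0.
  apply: contrapT => h'; apply: h; exists e; split => // z zN zy.
  by rewrite leNgt; apply/negP => hlt; apply: h'; exists z.
have dR : 0 < d%:R :> R by rewrite ltr0n.
pose f := e / (4 * d%:R).
have f0 : 0 < f by rewrite divr_gt0 // mulr_gt0.
exists (y + const_mx (2 * f)), f; split => // q p q0.
apply: contrapT => h.
have {}h i : `| (`|q|%:~R : R) `^ eta * (q%:~R * a ord0 i - (p ord0 i)%:~R) - (y ord0 i + 2 * f)| < f.
  by rewrite ltNge; apply/negP => hi; apply: h; exists i; rewrite !mxE.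
set z := ((`|q|%:~R : R) `^ eta) *: (q%:~R *: a - map_mx (fun z : int => z%:~R) p).
have hz i : f < z ord0 i - y ord0 i < 3 * f.
  by have := h i; rewrite !mxE ltr_norml => /andP[? ?]; apply/andP; split; lra.
have zy : z != y.
  apply: contraTneq (hz (Ordinal d0)) => ->; rewrite subrr negb_and -!leNgt.
  by rewrite ltW.
have := he z _ zy; rewrite leNgt => /(_ _)/negP; apply.
  by exists q, p.
apply: (@le_lt_trans _ _ (d%:R * (3 * f))).
  apply: edist_le => i; have /andP[h1 h2] := hz i.
  by rewrite ler_norml; apply/andP; split; lra.
have -> : d%:R * (3 * f) = 3 / 4 * e by rewrite /f; field; rewrite gt_eqF.
lra.
Qed.

(** * Dual approximations produced by a hole *)

Lemma powR_near1 (R : realType) (u eta tau : R) : 0 < eta -> eta <= 1 -> 0 < tau ->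
  tau <= 1 / 2 -> `|u - 1| <= tau -> `|u `^ eta - 1| <= tau.
Proof.
move=> e0 e1 t0 t1; rewrite !ler_norml => /andP[h1 h2].
have [u1|u1] := leP 1 u.
  have : u `^ eta <= u by apply: ler1_powR.
  have : 1 <= u `^ eta by rewrite -[leLHS](powRr0 u) ler_powR // ltW.
  by move=> ? ?; apply/andP; split; lra.
have u0 : 0 < u by lra.
have : u <= u `^ eta by apply: ger1_powR => //; rewrite u0 ltW.
have : u `^ eta <= 1.
  by rewrite -[leRHS](powRr0 u) ger_powR // ?u0 ltW.
by move=> ? ?; apply/andP; split; lra.
Qed.

(** The form attached to [M] is [A^2 (n + m.a)^2 + r^2 |m|^2]. A nonzero integer vector of value
    below [T1] is the required one. Otherwise [covering] provides [(q, p)] with [q] near [Q] and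
    [q a - p] near [y / Q^eta], which puts a point of [NA eta a] into the hole. *)
Lemma hole_dual_approx (R : realType) (d : nat) (eta : R) (a : 'rV[R]_d) : 0 < eta -> eta <= 1 ->
  hole eta a -> exists2 C : R, 0 < C & forall Q : R, 0 < Q ->
    exists (n : int) (m : 'rV[int]_d), ((n != 0) || (m != 0)) /\
      `|n%:~R + \sum_i (m ord0 i)%:~R * a ord0 i| <= C / Q /\
      forall i, `|(m ord0 i)%:~R| <= C * Q `^ eta.
Proof.
move=> eta0 eta1 [y [e [e0 hole]]].
have [T T0 cov] := covering R (1 + d).
pose Y := \sum_i `|y ord0 i|.
have Y0 : 0 <= Y by exact: sumr_ge0.
have hY i : `|y ord0 i| <= Y by rewrite /Y (bigD1 i) //= lerDl sumr_ge0.
(* [tau] bounds the relative error of [q] against [Q], whose effect on [y] is at most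
   [tau * Y <= e / 4]; [rho] will contribute [2 * rho = e / 4]. *)
pose tau := Num.min (1 / 2) (e / (4 * (Y + 1))).
have tau0 : 0 < tau by rewrite lt_min !divr_gt0 //; lra.
have tau1 : tau <= 1 / 2 by rewrite ge_min lexx.
have tau2 : tau * Y <= e / 4.
  have : tau <= e / (4 * (Y + 1)) by rewrite ge_min lexx orbT.
  rewrite ler_pdivlMr; last lra.
  have := mulr_ge0 (ltW tau0) Y0; nra.
pose rho := e / 8.
have rho0 : 0 < rho by rewrite divr_gt0.
pose T1 := T + 1.
have T10 : 0 < T1 by rewrite /T1; lra.
pose C := Num.sqrt T1 / tau + Num.sqrt T1 / rho.
have s0 : 0 < Num.sqrt T1 by rewrite sqrtr_gt0.
exists C; first by rewrite addr_gt0 // divr_gt0.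
move=> Q Q0.
pose A := tau * Q; pose r := rho / Q `^ eta.
have Qe : 0 < Q `^ eta by exact: powR_gt0.
have A0 : 0 < A by exact: mulr_gt0.
have r0 : 0 < r by exact: divr_gt0.
pose M : 'M[R]_(1 + d) := block_mx A%:M 0 (A *: a^T) r%:M.
have ME (z0 : R) (z : 'rV[R]_d) :
    dot (row_mx z0%:M z *m M) (row_mx z0%:M z *m M) =
    (A * (z0 + dot z a)) ^+ 2 + r ^+ 2 * dot z z.
  have -> : row_mx z0%:M z *m M = row_mx (A * (z0 + dot z a))%:M (r *: z).
    rewrite mul_row_block mulmx0 add0r -scalar_mxM -scalemxAr mul_mx_scalar.
    rewrite [z *m a^T]mx11_scalar -/(dot z a) scale_scalar_mx -raddfD /=.
    by rewrite mulrDr [z0 * A]mulrC.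
  rewrite dotE big_split_ord big_ord1 /= !row_mxEl mxE eqxx mulr1n -expr2.
  congr (_ + _); rewrite -dotZ [RHS]dotE; apply: eq_bigr => i _; by rewrite !row_mxEr.
have [[k [k0 hk]]|no] := pselect (exists k : 'rV[int]_(1 + d), k != 0 /\
    dot (map_mx intr k *m M) (map_mx intr k *m M) < T1).
  have kE : k = row_mx ((lsubmx k) 0 0)%:M (rsubmx k).
    by rewrite -mx11_scalar hsubmxK.
  move: k0 hk; rewrite kE; move: (lsubmx k 0 0) (rsubmx k) => n m k0.
  rewrite map_row_mx map_scalar_mx ME => hk.
  exists n, m; split.
    rewrite -negb_and; apply: contra k0 => /andP[/eqP -> /eqP ->].
    by rewrite raddf0 row_mx0.
  have d0 := dotvv_ge0 (map_mx intr m : 'rV[R]_d).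
  have sq (x B : R) : 0 < B -> (B * x) ^+ 2 < T1 -> `|x| <= Num.sqrt T1 / B.
    move=> B0 h; rewrite ler_pdivlMr // -[X in _ * X](gtr0_norm B0) -normrM mulrC.
    by rewrite -sqrtr_sqr ler_wsqrtr // ltW.
  split.
    apply: (@le_trans _ _ (Num.sqrt T1 / A)).
      have -> : n%:~R + \sum_i (m ord0 i)%:~R * a ord0 i = n%:~R + dot (map_mx intr m) a.
        by rewrite dotE; congr (_ + _); apply: eq_bigr => i _; rewrite [in RHS]mxE.
      by apply: sq => //; apply: le_lt_trans hk; rewrite lerDl mulr_ge0 // sqr_ge0.
    have -> : Num.sqrt T1 / A = Num.sqrt T1 / tau / Q by rewrite /A; field; rewrite !gt_eqF.
    rewrite ler_wpM2r ?invr_ge0 ?(ltW Q0) //.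
    by rewrite lerDl divr_ge0 // ltW.
  move=> i; apply: (@le_trans _ _ (Num.sqrt T1 / r)).
    apply: sq => //; apply: le_lt_trans hk.
    apply: (@le_trans _ _ (r ^+ 2 * dot (map_mx intr m) (map_mx intr m))).
      rewrite exprMn ler_wpM2l ?sqr_ge0 // dotE (bigD1 i) //= mxE -expr2 lerDl.
      by rewrite sumr_ge0 // => j _; rewrite -expr2 sqr_ge0.
    by rewrite lerDr sqr_ge0.
  have -> : Num.sqrt T1 / r = Num.sqrt T1 / rho * Q `^ eta by rewrite /r; field; rewrite !gt_eqF.
  rewrite ler_wpM2r ?(ltW Qe) //.
  by rewrite lerDr divr_ge0 // ltW.
exfalso.
have hM (m : 'rV[int]_(1 + d)) : m != 0 ->
    T1 <= dot (map_mx intr m *m M) (map_mx intr m *m M).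
  by move=> m0; rewrite leNgt; apply/negP => h; apply: no; exists m.
pose th : 'rV[R]_d := (Q `^ eta)^-1 *: y.
have [k hk] := cov _ M T1 T10 hM (row_mx Q%:M (Q *: a - th)).
have kE : k = row_mx ((lsubmx k) 0 0)%:M (rsubmx k).
  by rewrite -mx11_scalar hsubmxK.
move: hk; rewrite kE; move: (lsubmx k 0 0) (rsubmx k) => q p.
rewrite map_row_mx map_scalar_mx opp_row_mx add_row_mx -raddfB /= => hk.
have TT : T / T1 <= 1 by rewrite ler_pdivrMr // /T1; lra.
have dotrow (z0 w0 : R) (z w : 'rV[R]_d) :
    dot (row_mx z0%:M z) (row_mx w0%:M w) = z0 * w0 + dot z w.
  rewrite !dotE big_split_ord big_ord1 /= !row_mxEl !mxE eqxx !mulr1n.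
  by congr (_ + _); apply: eq_bigr => i _; rewrite !row_mxEr.
have hq : `|Q - q%:~R| <= A.
  have d0l (w : 'rV[R]_d) : dot 0 w = 0 by rewrite /dot mul0mx mxE.
  have d0r (w : 'rV[R]_d) : dot w 0 = 0 by rewrite /dot trmx0 mulmx0 mxE.
  have := hk (row_mx 1%:M 0); rewrite ME dotrow !d0l d0r mulr0 !addr0 !mulr1 => h.
  rewrite -(gtr0_norm A0) -(@ler_pXn2r _ 2) ?nnegrE // !real_normK ?num_real //.
  by apply: le_trans h _; rewrite ler_piMl // sqr_ge0.
have hp i : `|q%:~R * a ord0 i - (p ord0 i)%:~R - th ord0 i| <= r.
  (* The test vector [(a_i, - e_i)] makes [z0 + dot z a] vanish, so only [r] remains and the pairing
     is the error in coordinate [i]. *)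
  have := hk (row_mx (a ord0 i)%:M (- delta_mx 0 i)); rewrite ME dotrow.
  have dl (w : 'rV[R]_d) : dot (- delta_mx 0 i) w = - w ord0 i.
    rewrite dotE (bigD1 i) //= big1 => [|j ji].
      by rewrite !mxE !eqxx mulN1r addr0.
    by rewrite !mxE (negbTE ji) oppr0 mul0r.
  have dr (w : 'rV[R]_d) : dot w (- delta_mx 0 i) = - w ord0 i.
    by rewrite -dl !dotE; apply: eq_bigr => j _; rewrite mulrC.
  rewrite dr !dl subrr mulr0 expr0n /= add0r !mxE !eqxx opprK mulr1 => h.
  rewrite -(gtr0_norm r0) -(@ler_pXn2r _ 2) ?nnegrE // !real_normK ?num_real //.
  have r2 := sqr_ge0 r.
  apply: (@le_trans _ _ (T / T1 * r ^+ 2)); last by rewrite ler_piMl.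
  by apply: le_trans h; rewrite le_eqVlt; apply/orP; left; apply/eqP; rewrite ?mxE; ring.
have qR : Q / 2 <= q%:~R.
  by move: hq; rewrite /A ler_norml => /andP[? ?]; nra.
have q0 : 0 < q by rewrite -(ltr0z R); apply: lt_le_trans qR; rewrite divr_gt0.
have [i] := hole q p (lt0r_neq0 q0).
apply/negP; rewrite -ltNge.
rewrite (gtr0_norm q0).
pose u := q%:~R / Q : R.
have hu : `|u - 1| <= tau.
  have -> : u - 1 = (q%:~R - Q) / Q by rewrite /u; field; rewrite gt_eqF.
  by rewrite normrM normfV (gtr0_norm Q0) ler_pdivrMr // distrC.
have hu' := powR_near1 eta0 eta1 tau0 tau1 hu.
have u0 : 0 <= u by rewrite divr_ge0 ?ltW // ltr0z.
have -> : (q%:~R : R) `^ eta = Q `^ eta * u `^ eta.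
  by rewrite -powRM ?(ltW Q0) // /u mulrCA mulfV ?mulr1 ?gt_eqF.
have -> : Q `^ eta * u `^ eta * (q%:~R * a ord0 i - (p ord0 i)%:~R) - y ord0 i =
    u `^ eta * (Q `^ eta * (q%:~R * a ord0 i - (p ord0 i)%:~R - th ord0 i)) +
    (u `^ eta - 1) * y ord0 i.
  by rewrite !mxE; field; rewrite gt_eqF.
have h1 : `|Q `^ eta * (q%:~R * a ord0 i - (p ord0 i)%:~R - th ord0 i)| <= rho.
  rewrite normrM (gtr0_norm Qe) mulrC -ler_pdivlMr //; exact: hp.
apply: le_lt_trans (ler_normD _ _) _; rewrite !normrM.
have h2 : `|u `^ eta| <= 2.
  by move: hu'; rewrite !ler_norml => /andP[? ?]; apply/andP; split; lra.
have h3 : `|u `^ eta| * `|Q `^ eta * (q%:~R * a ord0 i - (p ord0 i)%:~R - th ord0 i)| <= 2 * rho.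
  exact: ler_pM.
have h4 : `|u `^ eta - 1| * `|y ord0 i| <= tau * Y by exact: ler_pM.
move: h3; rewrite normrM => h3.
apply: le_lt_trans (lerD h3 h4) _; rewrite /rho; lra.
Qed.

Lemma powR_unbounded (R : realType) (g K : R) : 0 < g -> exists2 N : nat, (0 < N)%N &
  forall x : R, N%:R <= x -> K <= x `^ g.
Proof.
move=> g0; pose K' := `|K| + 1.
have K0 : 0 < K' by rewrite /K' ltr_pwDr.
exists (Num.truncn (K' `^ g^-1)).+1 => // x hx.
have h : K' `^ g^-1 <= x by apply: le_trans hx; rewrite ltW // truncnS_gt.
have x0 : 0 <= x by apply: le_trans h; exact: powR_ge0.
apply: (@le_trans _ _ K'); first by rewrite /K' (le_trans (ler_norm K)) // lerDl.
have -> : K' = (K' `^ g^-1) `^ g by rewrite -powRrM mulVf ?gt_eqF // powRr1 // ltW.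
by apply: ge0_ler_powR; rewrite ?nnegrE ?powR_ge0 // ltW.
Qed.

(** * Dimension one: the exceptional points are the rationals *)

Section DimensionOne.
Variable R : realType.

Lemma notin_Kset1 (a : 'rV[R]_1) : ~ Kset a <-> Qset1 a.
Proof.
split.
  move=> aK; apply: contrapT => aQ; apply: aK => c0 c.
  rewrite big_ord1 => h.
  have c1 : c ord0 = 0.
    apply/eqP; apply: contraPT h => c1 h; apply: aQ; exists (- c0 / c ord0).
    rewrite rmorphM /= fmorphV rmorphN /=.
    have c1' : ratr (c ord0) != 0 :> R by rewrite fmorph_eq0.
    apply: (mulfI c1'); rewrite mulrCA mulfV // mulr1.
    by apply/eqP; rewrite -addr_eq0 addrC h.
  split; last by move=> i; rewrite ord1.
  by move: h; rewrite c1 rmorph0 mul0r addr0 => /eqP; rewrite fmorph_eq0 => /eqP.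
move=> [q aq] aK; have [|_ /(_ ord0)/eqP] := aK (- q) (fun=> 1).
  by rewrite big_ord1 rmorphN rmorph1 mul1r aq addNr.
by rewrite oner_eq0.
Qed.

(** Every [q a - p] is a multiple of [1 / v], with [v] the denominator of [a], and [|q|^eta >= 1].
    So no point of [NA eta a] lies strictly between 0 and [1 / v]; the hole is centred halfway. *)
Lemma rational_hole (eta : R) (a : 'rV[R]_1) : 0 < eta -> Qset1 a -> hole eta a.
Proof.
move=> eta0 [u au].
have v0 : 0 < (denq u)%:~R :> R by rewrite ltr0z denq_gt0.
set v := (denq u)%:~R : R in v0.
exists (const_mx (1 / (2 * v))), (1 / (2 * v)).
have e0 : 0 < 1 / (2 * v) by rewrite divr_gt0 // mulr_gt0.
split => // q p q0; exists ord0.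
have q1 : 1 <= (`|q|%:~R : R) `^ eta.
  rewrite -[leLHS](powRr0 (`|q|%:~R)) ler_powR //; last exact: ltW.
  by rewrite ler1z -gtz0_ge1 normr_gt0.
pose N := q * numq u - p ord0 ord0 * denq u.
have -> : q%:~R * a ord0 ord0 - (p ord0 ord0)%:~R = N%:~R / v.
  rewrite au /N rmorphB !rmorphM /= -/v.
  have -> : ratr u = (numq u)%:~R / v :> R by [].
  by field; rewrite gt_eqF.
rewrite mxE; set t := _ `^ eta in q1 *.
have -> : t * (N%:~R / v) - 1 / (2 * v) = (2 * t * N%:~R - 1) / (2 * v).
  by field; rewrite gt_eqF.
rewrite normrM (@gtr0_norm _ (2 * v)^-1) ?invr_gt0 ?mulr_gt0 //.
rewrite ler_wpM2r ?invr_ge0 ?mulr_ge0 ?(ltW v0) //.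
have [->|N0] := eqVneq N 0; first by rewrite mulr0 sub0r normrN1.
have N1 : 1 <= `|N%:~R : R| by rewrite -intr_norm ler1z -gtz0_ge1 normr_gt0.
rewrite -[leLHS](_ : 2 - 1 = 1); last by lra.
apply: le_trans (lerB_dist _ _); rewrite normr1 lerD2r !normrM.
rewrite (@ger0_norm _ 2) // (ger0_norm (le_trans ler01 q1)).
nra.
Qed.

(** The vectors for [Q = j + 1] and [Q = j + 2] have an integer determinant of size
    [O(Q^(eta - 1))], hence zero for large [j]. All later vectors share one ratio [z], and
    [|X + z| <= C / (j + 1)] forces [X = - z]. *)
Lemma hole1_rational (eta : R) (a : 'rV[R]_1) : 0 < eta -> eta < 1 -> hole eta a -> Qset1 a.
Proof.
move=> eta0 eta1 /(hole_dual_approx eta0 (ltW eta1))[C C0 H].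
set X := a ord0 ord0.
have H1 : forall j : nat, exists nm : int * int, (nm.1 != 0 \/ nm.2 != 0) /\
    `|nm.1%:~R + nm.2%:~R * X| <= C / j.+1%:R /\
    `|nm.2%:~R| <= C * j.+1%:R `^ eta.
  move=> j; have [n [m [h0 [h1 h2]]]] := H j.+1%:R (ltr0Sn _ _).
  exists (n, m ord0 ord0) => /=; split.
    case/orP: h0 => h; first by left.
    right; apply: contra h => /eqP h; apply/eqP/rowP => i.
    by rewrite mxE !ord1.
  by split; [move: h1; rewrite big_ord1|exact: h2].
have [n hn] := choice H1.
have g0 : 0 < 1 - eta by lra.
have [N N0 hN] := powR_unbounded (4 * C ^+ 2) g0.
have [N' N'0 hN'] := powR_unbounded (C + 1) (@ltr01 R).
pose J := (N + N')%N.
have hJ j : (J <= j)%N -> C < j.+1%:R /\ 4 * C ^+ 2 <= j.+1%:R `^ (1 - eta) :> R.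
  move=> jJ; split.
    apply: (@lt_le_trans _ _ (C + 1)); first by rewrite ltrDl.
    rewrite -[leRHS]powRr1 //; apply: hN'; rewrite ler_nat.
    by apply: leq_trans (leqW jJ); rewrite leq_addl.
  by apply: hN; rewrite ler_nat; apply: leq_trans (leqW jJ); rewrite leq_addr.
have m0 j : (J <= j)%N -> (n j).2 != 0.
  move=> /hJ[jC _]; have [[n0|//] [h1 _]] := hn j.
  apply: contraT => /negPn/eqP h; move: h1; rewrite h mul0r addr0.
  rewrite -intr_norm => h1.
  have : 1 <= (`|(n j).1|%:~R : R) by rewrite ler1z -gtz0_ge1 normr_gt0.
  have : C / j.+1%:R < 1 by rewrite ltr_pdivrMr ?mul1r // ltr0Sn.
  by move=> h2 h3; have := le_lt_trans (le_trans h3 h1) h2; rewrite ltxx.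
have eq1 j : (J <= j)%N -> (n j).1 * (n j.+1).2 = (n j.+1).1 * (n j).2.
  move=> jJ; have [_ big] := hJ j jJ.
  have [_ [h1 h2]] := hn j; have [_ [h3 h4]] := hn j.+1.
  apply/eqP; rewrite -subr_eq0; set D := _ - _.
  apply: contraT => D0.
  have D1 : 1 <= `|D%:~R : R| by rewrite -intr_norm ler1z -gtz0_ge1 normr_gt0.
  have DE : D%:~R = ((n j).1%:~R + (n j).2%:~R * X) * (n j.+1).2%:~R -
     ((n j.+1).1%:~R + (n j.+1).2%:~R * X) * (n j).2%:~R :> R.
    by rewrite /D rmorphB !rmorphM /=; ring.
  set Q : R := j.+1%:R in h1 h2 big.
  have Q0 : 0 < Q by rewrite ltr0Sn.
  have Q1 : 1 <= Q by rewrite ler1n.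
  have QS : j.+2%:R = Q + 1 by rewrite /Q natr1.
  have P0 : 0 < Q `^ eta by exact: powR_gt0.
  have pw : (Q + 1) `^ eta <= 2 * Q `^ eta.
    apply: (@le_trans _ _ ((2 * Q) `^ eta)).
      apply: ge0_ler_powR; rewrite ?nnegrE ?(ltW eta0) //; lra.
    rewrite powRM ?(ltW Q0) // ler_wpM2r ?(ltW P0) //.
    by apply: ler1_powR; lra.
  have b1 : `|((n j).1%:~R + (n j).2%:~R * X) * (n j.+1).2%:~R| <= C / Q * (C * (2 * Q `^ eta)).
    rewrite normrM; apply: ler_pM => //; apply: le_trans h4 _.
    by rewrite QS ler_wpM2l // ltW.
  have b2 : `|((n j.+1).1%:~R + (n j.+1).2%:~R * X) * (n j).2%:~R| <= C / Q * (C * Q `^ eta).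
    rewrite normrM; apply: ler_pM => //; apply: le_trans h3 _.
    rewrite QS ler_wpM2l ?(ltW C0) // lef_pV2 ?posrE //; lra.
  have b3 : 1 <= C / Q * (C * (3 * Q `^ eta)).
    apply: le_trans D1 _; rewrite DE; apply: le_trans (ler_normB _ _) _.
    by apply: le_trans (lerD b1 b2) _; rewrite le_eqVlt; apply/orP; left; apply/eqP; ring.
  have QE : Q = Q `^ eta * Q `^ (1 - eta).
    rewrite -powRD; last by rewrite (gt_eqF Q0) implybT.
    by rewrite addrCA subrr addr0 powRr1 // ltW.
  have : Q <= 3 * C ^+ 2 * Q `^ eta.
    rewrite -[leLHS]mul1r -ler_pdivlMr //; apply: le_trans b3 _.
    by rewrite le_eqVlt; apply/orP; left; apply/eqP; field; rewrite gt_eqF.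
  rewrite {1}QE [_ * Q `^ eta]mulrC ler_pM2l // => h.
  have h5 := exprn_gt0 2 C0; by suff : False by []; lra.
pose z : rat := (n J).1%:~R / (n J).2%:~R.
have zE j : (J <= j)%N -> (n j).1%:~R = z * (n j).2%:~R.
  elim: j => [|j IH].
    by rewrite leqn0 => /eqP J0; rewrite /z J0 divfK // intr_eq0 m0 // J0.
  rewrite leq_eqVlt => /orP[/eqP <-|]; first by rewrite /z divfK // intr_eq0 m0.
  rewrite ltnS => jJ; have := eq1 j jJ; have := IH jJ.
  move=> h /(congr1 (fun t : int => t%:~R : rat)); rewrite !rmorphM /= h => h'.
  have mj : ((n j).2%:~R : rat) != 0 by rewrite intr_eq0 m0.
  by apply: (mulIf mj); rewrite -h' mulrAC.
exists (- z); rewrite -/X rmorphN /=; apply/eqP; rewrite -addr_eq0; apply: contraT => Xz.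
have d0 : 0 < `|X + ratr z| by rewrite normr_gt0.
have [N2 _ hN2] := powR_unbounded (C / `|X + ratr z| + 1) (@ltr01 R).
pose j := (J + N2)%N.
have jJ : (J <= j)%N by rewrite leq_addr.
have [_ [h1 _]] := hn j.
have : (n j).1%:~R + (n j).2%:~R * X = (n j).2%:~R * (X + ratr z).
  have := congr1 (@ratr R) (zE j jJ); rewrite rmorphM /= !ratr_int => ->; ring.
move=> E; move: h1; rewrite E normrM.
have : 1 <= `|(n j).2%:~R : R| by rewrite -intr_norm ler1z -gtz0_ge1 normr_gt0 m0.
move=> m1 h1.
have : `|X + ratr z| <= C / j.+1%:R by apply: le_trans h1; rewrite ler_peMl.
rewrite ler_pdivlMr ?ltr0Sn // mulrC -ler_pdivlMr // => h.
have := hN2 j.+1%:R; rewrite powRr1 // ler_nat => /(_ _); move=> /(_ (leqW (leq_addl _ _))) h6.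
by suff : False by []; lra.
Qed.

End DimensionOne.

(** * Hausdorff measure of limsup sets *)

Lemma nneseries_le_bound (R : realType) (u : nat -> \bar R) (M : \bar R) : (forall n, 0 <= u n)%E ->
  (forall N, \sum_(0 <= i < N) u i <= M)%E -> (\sum_(0 <= i <oo) u i <= M)%E.
Proof.
move=> u0 h; apply: (lime_le (is_cvg_nneseries _)) => [n _ _|]; first exact: u0.
exact: nearW.
Qed.

Section Hausdorff.
Variables (R : realType) (d : nat).
Implicit Types (A : set 'rV[R]_d) (s h : R).

Lemma ediam_le A h : (forall x y, A x -> A y -> edist x y <= h) -> (ediam A <= h%:E)%E.
Proof.
by move=> hA; apply: ge_ereal_sup => _ [x Ax [y Ay <-]]; rewrite lee_fin; exact: hA.
Qed.

Lemma edist_le_ediam A x y : A x -> A y -> ((edist x y)%:E <= ediam A)%E.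
Proof. by move=> Ax Ay; apply: ereal_sup_ubound; exists x => //; exists y. Qed.

Lemma edist_ge0 (x y : 'rV[R]_d) : 0 <= edist x y.
Proof. exact: sqrtr_ge0. Qed.

Lemma ediam_ge0 A x : A x -> (0 <= ediam A)%E.
Proof. by move=> Ax; apply: le_trans (edist_le_ediam Ax Ax); rewrite lee_fin edist_ge0. Qed.

Lemma hcontrib_ge0 s A : (0 <= hcontrib s A)%E.
Proof. by rewrite /hcontrib; case: ifP => // _; rewrite lee_fin powR_ge0. Qed.

Lemma hcontrib_le s h A : 0 <= s -> 0 <= h -> (forall x y, A x -> A y -> edist x y <= h) ->
  (hcontrib s A <= (h `^ s)%:E)%E.
Proof.
move=> s0 h0 hA; rewrite /hcontrib; case: ifP => [_|].
  by rewrite lee_fin powR_ge0.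
move=> /negbT/asboolPn/eqP/set0P[x Ax].
have := ediam_le hA; have := ediam_ge0 Ax.
case: (ediam A) => [r| |] //=; rewrite !lee_fin => r0 rh.
by apply: ge0_ler_powR.
Qed.

Lemma hmeasure_ge0 s A : (0 <= hmeasure s A)%E.
Proof.
apply: (@le_trans _ _ (hcontent 1 s A)).
  apply: le_ereal_inf_tmp => _ [F _ <-]; apply: nneseries_ge0 => n _ _.
  exact: hcontrib_ge0.
by apply: ereal_sup_ubound; exists 1 => //=.
Qed.

(* The cover is indexed by the pairs (k, t), K <= k, enumerated through nat * nat. *)
Lemma limsup_hmeasure0 (s : R) A (T : nat -> finType)
    (S : forall k, T k -> set 'rV[R]_d) (h : nat -> R) :
  0 <= s ->
  (forall k, 0 <= h k) ->
  (forall k t x y, S k t x -> S k t y -> edist x y <= h k) ->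
  (forall e, 0 < e -> exists K, (forall k, (K <= k)%N -> h k <= e) /\
      forall N, \sum_(K <= k < N) #|T k|%:R * h k `^ s <= e) ->
  (forall x, A x -> forall k0, exists k, (k0 <= k)%N /\ exists t, S k t x) ->
  hmeasure s A = 0%E.
Proof.
move=> s0 h0 hS hK cov; apply/eqP; rewrite eq_le hmeasure_ge0 andbT.
apply: ge_ereal_sup => _ [delta /= delta0 <-].
apply/lee_addgt0Pr => e e0; rewrite add0e.
pose e' := Num.min e delta.
have [K [K1 K2]] : exists K, (forall k, (K <= k)%N -> h k <= e') /\
      forall N, \sum_(K <= k < N) #|T k|%:R * h k `^ s <= e'.
  by apply: hK; rewrite lt_min e0 delta0.
pose G (p : nat * nat) := [set x | exists t : T p.1, (K <= p.1)%N /\ enum_rank t = p.2 :> nat /\ S p.1 t x].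
pose b (p : nat * nat) : \bar R := (((K <= p.1)%N && (p.2 < #|T p.1|)%N)%:R * h p.1 `^ s)%:E.
have b0 p : (0 <= b p)%E by rewrite lee_fin mulr_ge0 // powR_ge0.
have hG p x y : G p x -> G p y -> edist x y <= h p.1.
  move=> [t [_ [ht Stx]]] [t' [_ [ht' St'y]]]; apply: hS Stx _.
  by have -> : t = t' by apply: enum_rank_inj; apply: val_inj; rewrite /= ht ht'.
pose F n := if @pickle_inv (nat * nat)%type n is Some p then G p else set0.
pose B n := if @pickle_inv (nat * nat)%type n is Some p then b p else 0%E.
have hB n : (hcontrib s (F n) <= B n)%E.
  rewrite /F /B; case: (pickle_inv n) => [p|]; last by rewrite /hcontrib asboolT.
  have [H|H] := boolP ((K <= p.1)%N && (p.2 < #|T p.1|)%N).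
    by rewrite /b H mul1r; apply: hcontrib_le => //; exact: hG.
  rewrite /hcontrib asboolT //; apply/seteqP; split => // x [t [Kp [tp _]]].
  by move: H; rewrite Kp -tp ltn_ord.
have B0 n : (0 <= B n)%E by rewrite /B; case: (pickle_inv n).
apply: (@le_trans _ _ (\sum_(0 <= n <oo) hcontrib s (F n))%E).
  apply: ereal_inf_lbound; exists F => //; split.
    move=> x /cov/(_ K)[k [Kk [t St]]].
    exists (pickle (k, enum_rank t : nat)) => //.
    by rewrite /F pickleK_inv; exists t.
  move=> n; rewrite /F; case: (pickle_inv n) => [p|]; last exact: ediam_le.
  apply: ediam_le => x y Gx Gy; have [_ [Kp _]] := Gx.
  by apply: le_trans (hG p x y Gx Gy) _; apply: le_trans (K1 _ Kp) _; rewrite ge_min lexx orbT.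
apply: (@le_trans _ _ (\sum_(0 <= n <oo) B n)%E).
  by apply: lee_nneseries => n *; [exact: hcontrib_ge0|exact: hB].
rewrite nneseries_esumT //.
have -> : (\esum_(n in [set: nat]) B n = \esum_(n in range (@pickle (nat * nat)%type)) B n)%E.
  rewrite [RHS]esum_mkcond; apply: eq_esum => n _.
  case: ifPn => //; rewrite notin_setE => hn; rewrite /B.
  have := @pickle_invK (nat * nat)%type n; case: (pickle_inv n) => [p /= hp|//].
  by exfalso; apply: hn; exists p.
rewrite esum_image; last by move=> p q _ _; exact: (pcan_inj (@pickleK _)).
have -> : (\esum_(p in [set: nat * nat]) B (pickle p) = \esum_(p in [set: nat * nat]) b (p.1, p.2))%E.
  by apply: eq_esum => -[k i] _; rewrite /B pickleK_inv.
have -> : [set: nat * nat] = [set: nat] `*`` (fun=> [set: nat]) by apply/seteqP; split.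
rewrite -(@esum_esum _ _ _ _ _ (fun k i => b (k, i))) //.
have bE k : (\esum_(i in [set: nat]) b (k, i) <= ((K <= k)%N%:R * (#|T k|%:R * h k `^ s))%:E)%E.
  rewrite -nneseries_esumT //; apply: nneseries_le_bound => // N.
  rewrite sumEFin lee_fin /= -mulr_suml mulrA ler_wpM2r ?powR_ge0 //.
  case: (K <= k)%N => /=; last by rewrite big1 ?mul0r.
  rewrite mul1r -natr_sum ler_nat.
  have -> : (\sum_(0 <= i < N) (i < #|T k|) = minn N #|T k|)%N; last exact: geq_minr.
  elim: N => [|N IH]; first by rewrite big_geq // min0n.
  by rewrite big_nat_recr //= IH; case: ltnP => h1 /=; lia.
rewrite -nneseries_esumT; last by move=> k; apply: esum_ge0.
apply: (@le_trans _ _ (\sum_(0 <= k <oo) ((K <= k)%N%:R * (#|T k|%:R * h k `^ s))%:E)%E).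
  by apply: lee_nneseries => k *; [exact: esum_ge0|exact: bE].
apply: nneseries_le_bound => [k|N].
  by rewrite lee_fin !mulr_ge0 // powR_ge0.
rewrite sumEFin lee_fin; apply: (@le_trans _ _ e'); last by rewrite ge_min lexx.
rewrite [leLHS](_ : _ = \sum_(0 <= k < N | (K <= k)%N) #|T k|%:R * h k `^ s); last first.
  by rewrite [RHS]big_mkcond; apply: eq_bigr => k _; case: ifP; rewrite ?mul1r ?mul0r.
have nn k : 0 <= #|T k|%:R * h k `^ s by rewrite mulr_ge0 ?powR_ge0.
have [KN|KN] := leqP K N.
  apply: le_trans (K2 N).
  rewrite (big_cat_nat (leq0n K) KN) /= [X in X + _]big1_seq ?add0r; last first.
    by move=> k; rewrite mem_index_iota => /andP[Kk /andP[_ kK]]; have := leq_ltn_trans Kk kK; rewrite ltnn.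
  rewrite big_mkcond; apply: ler_sum => k _; by case: ifP.
rewrite big1_seq ?le_min ?(ltW e0) ?(ltW delta0) // => k; rewrite mem_index_iota => /andP[Kk /andP[_ kN]]; have := leq_ltn_trans Kk (ltn_trans kN KN); by rewrite ltnn.
Qed.

End Hausdorff.

(** Integers of absolute value at most [L] are coded by ordinals because covers and gaps below are
    indexed by finite types; outside this range the code is meaningless. *)
Definition enc (L : nat) (z : int) : 'I_(2 * L).+1 := inord (absz (z + L%:Z)).
Definition dec (L : nat) (c : 'I_(2 * L).+1) : int := (c : nat)%:Z - L%:Z.

Lemma encK L z : (`|z| <= L%:Z) -> dec (enc L z) = z.
Proof. by move=> h; rewrite /dec /enc inordK; lia. Qed.

Lemma intr_norm_le (R : realType) (z : int) (x : R) (N : nat) : `|z%:~R| <= x -> x < N%:R + 1 ->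
  `|z| <= N%:Z.
Proof.
move=> h1 h2; have := le_lt_trans h1 h2.
by rewrite -intr_norm natr1 pmulrn ltr_int; lia.
Qed.

Lemma geometric_tail (R : realFieldType) (c : R) K N : 0 < c -> c < 1 ->
  \sum_(K <= k < N) c ^+ k <= c ^+ K / (1 - c).
Proof.
move=> c0 c1; have c2 : 0 < 1 - c by lra.
have [NK|/ltnW KN] := leqP N K; first by rewrite big_geq // divr_ge0 ?exprn_ge0 // ltW.
rewrite ler_pdivlMr // -(subnKC KN).
suff -> : (\sum_(K <= k < K + (N - K)) c ^+ k) * (1 - c) = c ^+ K - c ^+ (K + (N - K)).
  by rewrite gerBl exprn_ge0 // ltW.
elim: (N - K)%N => [|n IH]; first by rewrite addn0 big_geq // mul0r subrr.
rewrite addnS big_nat_recr ?leq_addr //= mulrDl IH exprS; ring.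
Qed.

(** * Points lying in infinitely many slabs *)

Section SlabLimsup.
Variables (R : realType) (d : nat) (w : R).

Definition slab (k : nat) (x : 'rV[R]_d.+1) (n : int) (m : 'rV[int]_d.+1) (i : 'I_d.+1) :=
  [/\ (2 ^+ k : R) <= `|(m ord0 i)%:~R|, (`|(m ord0 i)%:~R| : R) < 2 ^+ k.+1,
    forall j, (`|(m ord0 j)%:~R| : R) <= `|(m ord0 i)%:~R| &
    `|n%:~R + \sum_j (m ord0 j)%:~R * x ord0 j| <= (2 ^+ k) `^ (- w)].

(** At level [X = 2^k] a slab has width about [h = X^(-(1+w))] and is cut into cells of side about
    [h] in the [d] coordinates other than [i]. With about [X^(d+1)] vectors [m], [X] integers [n]
    and [h^(-d)] cells, the cover costs [X^(d+2) h^(s-d)], a negative power of [X] by the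
    hypothesis. *)
Lemma slab_limsup_hmeasure0 (s : R) (A : set 'rV[R]_d.+1) : 0 < w -> 0 <= s ->
  d%:R + 2 < (1 + w) * (s - d%:R) ->
  (forall x, A x -> forall k0, exists k, (k0 <= k)%N /\ exists n m i, slab k x n m i) ->
  hmeasure s A = 0%E.
Proof.
move=> w0 s0 hs hA.
pose D : R := d.+1%:R.
have D1 : 1 <= D by rewrite ler1n.
pose g := (1 + w) * (s - d%:R) - (d%:R + 2).
have g0 : 0 < g by rewrite /g; lra.
(* [A] may be unbounded, so level [k] covers the box of half-side [M k = X^kap]. This adds a factor
   [M^(d+1) = X^(g/2)], half of the available decay [X^(-g)]. *)
pose kap := g / (2 * D).
have kap0 : 0 < kap by rewrite divr_gt0 // mulr_gt0 //; lra.
pose X k : R := 2 ^+ k.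
have X1 k : 1 <= X k by rewrite exprn_ege1 // ler1n.
have X0 k : 0 < X k by exact: lt_le_trans (X1 k).
pose M k := X k `^ kap.
have M1 k : 1 <= M k by rewrite -[leLHS](powRr0 (X k)) ler_powR // ltW.
pose h k := X k `^ (- (1 + w)).
have h0 k : 0 < h k by exact: powR_gt0.
have h1 k : h k <= 1.
  by rewrite -[leRHS](powRr0 (X k)) ler_powR // oppr_le0; lra.
pose L k := (2 ^ k.+1)%N.
have LE k : (L k)%:R = 2 * X k by rewrite /L natrX exprS.
pose Nn k := (Num.truncn (1 + 2 * D * X k * M k)).+1.
pose G k := (Num.truncn (M k / h k)).+2.
pose T k : finType := ('I_d.+1 * {ffun 'I_d.+1 -> 'I_(2 * L k).+1} * 'I_(2 * Nn k).+1 *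
   {ffun 'I_d -> 'I_(2 * G k).+1})%type.
pose S k (t : T k) := [set x : 'rV[R]_d.+1 |
  [/\ X k <= `|(dec (t.1.1.2 t.1.1.1))%:~R|,
   forall j, (`|(dec (t.1.1.2 j))%:~R| : R) <= `|(dec (t.1.1.2 t.1.1.1))%:~R|,
   `|(dec t.1.2)%:~R + \sum_j (dec (t.1.1.2 j))%:~R * x ord0 j| <= X k `^ (- w) &
   forall j, `|x ord0 (lift t.1.1.1 j) - (dec (t.2 j))%:~R * h k| <= h k]].
pose H k := 2 * D ^+ 2 * h k.
have hX k : X k `^ (- w) = X k * h k.
  rewrite /h -{2}(powRr1 (ltW (X0 k))) -powRD; last by rewrite (gt_eqF (X0 k)) implybT.
  by congr (_ `^ _); ring.
pose C : R := D * 5 ^+ d.+1 * (9 * D) * 7 ^+ d * (2 * D ^+ 2) `^ s.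
have C0 : 0 < C.
  rewrite /C !mulr_gt0 ?exprn_gt0 ?powR_gt0 //; try lra.
  by rewrite mulr_gt0 // exprn_gt0 //; lra.
pose c : R := 2 `^ (- (g / 2)).
have c0 : 0 < c by exact: powR_gt0.
have c1 : c < 1.
  rewrite /c powRN invf_lt1 ?powR_gt0 // -[ltLHS](_ : 1 `^ (g / 2) = 1); last by rewrite powR1.
  by rewrite gt0_ltr_powR ?nnegrE ?divr_gt0 // ltr1n.
have cE k : c ^+ k = X k `^ (- (g / 2)).
  by rewrite /c -powR_mulrn ?powR_ge0 // powRAC powR_mulrn.
have card k : #|T k|%:R * H k `^ s <= C * c ^+ k.
  have MhE : 1 <= M k / h k by rewrite ler_pdivlMr // mul1r (le_trans (h1 k)).
  have e1 : (2 * L k).+1%:R <= 5 * X k.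
    by rewrite -natr1 natrM LE; have := X1 k; lra.
  have XM1 : 1 <= D * X k * M k.
    by rewrite !mulr_ege1 // !mulr_ge1.
  have e2 : (2 * Nn k).+1%:R <= 9 * (D * X k * M k).
    rewrite /Nn -natr1 natrM -natr1.
    have : (Num.truncn (1 + 2 * D * X k * M k))%:R <= 1 + 2 * D * X k * M k.
      rewrite truncn_le; lra.
    lra.
  have e3 : (2 * G k).+1%:R <= 7 * (M k / h k).
    rewrite /G -natr1 natrM -natr1 -natr1.
    have : (Num.truncn (M k / h k))%:R <= M k / h k.
      rewrite truncn_le; lra.
    lra.
  rewrite /T !card_prod !card_ffun !card_ord !natrM !natrX -/D.
  have H2 : H k `^ s = (2 * D ^+ 2) `^ s * h k `^ s.
    by rewrite /H powRM ?mulr_ge0 ?sqr_ge0 // ltW.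
  apply: (@le_trans _ _ (D * (5 * X k) ^+ d.+1 * (9 * (D * X k * M k)) *
       (7 * (M k / h k)) ^+ d * H k `^ s)).
    rewrite ler_wpM2r ?powR_ge0 //.
    have D0 : 0 <= D by lra.
    apply: ler_pM; rewrite ?mulr_ge0 ?exprn_ge0 //.
      apply: ler_pM; rewrite ?mulr_ge0 ?exprn_ge0 //.
      by rewrite ler_wpM2l // lerXn2r // nnegrE // (le_trans _ e1).
    by rewrite lerXn2r // nnegrE // (le_trans _ e3).
  rewrite H2 !exprMn exprVn.
  have -> : D * (5 ^+ d.+1 * X k ^+ d.+1) * (9 * (D * X k * M k)) *
     (7 ^+ d * (M k ^+ d / h k ^+ d)) * ((2 * D ^+ 2) `^ s * h k `^ s) =
     C * (X k ^+ d.+2 * M k ^+ d.+1 * (h k `^ s / h k ^+ d)).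
    by rewrite /C !exprS; ring.
  rewrite ler_wpM2l ?(ltW C0) // le_eqVlt; apply/orP; left; apply/eqP.
  have hE : h k `^ s / h k ^+ d = h k `^ (s - d%:R).
    by rewrite powRD ?(gt_eqF (h0 k)) ?implybT // powRN powR_mulrn // ltW.
  rewrite cE hE /M /h -!powRrM -!powR_mulrn ?powR_ge0 ?(ltW (X0 k)) // -?powRrM.
  rewrite -!powRD ?(gt_eqF (X0 k)) ?implybT //.
  congr (_ `^ _); rewrite /kap -/D.
  have -> : d.+2%:R = d%:R + 2 :> R by rewrite -addn2 natrD.
  by rewrite /g; field; lra.
apply: (@limsup_hmeasure0 _ _ _ _ T S H) => //.
- by move=> k; rewrite !mulr_ge0 ?sqr_ge0 // ltW.
- move=> k [[[i m] n] gr] x y [/= m0 mj hx1 hx2] [/= _ _ hy1 hy2].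
  have hl j : `|x ord0 (lift i j) - y ord0 (lift i j)| <= 2 * h k.
    by move: (hx2 j) (hy2 j); rewrite !ler_norml => /andP[? ?] /andP[? ?]; apply/andP; split; lra.
  have D0 : 0 < D by lra.
  (* Since [m_i] dominates, the slab condition determines coordinate [i] from the others up to
     [2 h + 2 d h]. *)
  have bound j : `|x ord0 j - y ord0 j| <= 2 * D * h k.
    have [->|ij] := eqVneq j i; last first.
      have /unlift_some[j' -> _] : i != j by rewrite eq_sym.
      apply: le_trans (hl j') _; rewrite ler_wpM2r ?(ltW (h0 k)) //; lra.
    set a : R := (dec (m i))%:~R in m0 mj *.
    have a0 : 0 < `|a| by exact: lt_le_trans m0.
    rewrite -(ler_pM2l a0) -normrM.
    have -> : a * (x ord0 i - y ord0 i) =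
        ((dec n)%:~R + \sum_j (dec (m j))%:~R * x ord0 j) -
        ((dec n)%:~R + \sum_j (dec (m j))%:~R * y ord0 j) -
        \sum_j (dec (m (lift i j)))%:~R * (x ord0 (lift i j) - y ord0 (lift i j)).
      rewrite (bigD1_ord i) //= [\sum_j _ * y ord0 j](bigD1_ord i) //= -/a.
      rewrite (_ : \sum_j _ * (_ - _) =
          \sum_j (dec (m (lift i j)))%:~R * x ord0 (lift i j) -
          \sum_j (dec (m (lift i j)))%:~R * y ord0 (lift i j)); first by ring.
      by rewrite -sumrB; apply: eq_bigr => j' _; rewrite mulrBr.
    apply: le_trans (ler_normB _ _) _.
    have s1 : `|\sum_j (dec (m (lift i j)))%:~R * (x ord0 (lift i j) - y ord0 (lift i j))| <=
        `|a| * (d%:R * (2 * h k)).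
      apply: le_trans (ler_norm_sum _ _ _) _.
      apply: (@le_trans _ _ (\sum_(j < d) `|a| * (2 * h k))).
        by apply: ler_sum => j1 _; rewrite normrM ler_pM.
      by rewrite sumr_const card_ord -[X in X <= _]mulr_natr; lra.
    have s2 := ler_normB ((dec n)%:~R + \sum_j (dec (m j))%:~R * x ord0 j)
        ((dec n)%:~R + \sum_j (dec (m j))%:~R * y ord0 j).
    have s3 : X k `^ (- w) <= `|a| * h k by rewrite hX ler_wpM2r // ltW.
    have DE : D = d%:R + 1 by rewrite /D natr1.
    by rewrite DE; lra.
  apply: le_trans (edist_le bound) _.
  by rewrite -/D /H le_eqVlt; apply/orP; left; apply/eqP; ring.
- move=> e e0.
  have [N1 N1p hN1] := powR_unbounded (C / (1 - c) / e) (divr_gt0 g0 (@ltr0n R 2)).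
  have w1 : 0 < 1 + w by lra.
  have [N2 N2p hN2] := powR_unbounded (2 * D ^+ 2 / e) w1.
  have Xk k : k%:R <= X k by rewrite /X -natrX ler_nat ltnW // ltn_expl.
  exists (N1 + N2)%N; split.
    move=> k kN; rewrite /H /h powRN ler_pdivrMr ?powR_gt0 // [leRHS]mulrC -ler_pdivrMr //.
    by apply: hN2; apply: le_trans (Xk k); rewrite ler_nat (leq_trans _ kN) // leq_addl.
  move=> N; apply: (@le_trans _ _ (\sum_(N1 + N2 <= k < N) C * c ^+ k)).
    by apply: ler_sum => k _; exact: card.
  rewrite -mulr_sumr.
  have c2 : 0 < 1 - c by lra.
  apply: (@le_trans _ _ (C * (c ^+ (N1 + N2) / (1 - c)))).
    by rewrite ler_wpM2l ?(ltW C0) // geometric_tail.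
  rewrite cE powRN mulrCA mulrC.
  rewrite ler_pdivrMr ?powR_gt0 // [leRHS]mulrC -ler_pdivrMr //.
  by apply: hN1; apply: le_trans (Xk _); rewrite ler_nat leq_addr.
move=> x Ax k0.
have [N1 N1p hN1] := powR_unbounded (\sum_j `|x ord0 j|) kap0.
have [k [kk [n [m [i [m1 m2 m3 hx]]]]]] := hA x Ax (k0 + N1)%N.
exists k; split; first exact: leq_trans (leq_addr _ _) kk.
have xM j : `|x ord0 j| <= M k.
  apply: (@le_trans _ _ (\sum_j `|x ord0 j|)).
    by rewrite (bigD1 j) //= lerDl sumr_ge0.
  apply: hN1; rewrite /X -natrX ler_nat ltnW // (leq_ltn_trans _ (ltn_expl _ _)) //.
  by apply: leq_trans kk; rewrite leq_addl.
have mL j : dec (enc (L k) (m ord0 j)) = m ord0 j.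
  apply: encK; apply: (@intr_norm_le R _ _ _ (m3 j)).
  by rewrite LE; apply: lt_trans m2 _; rewrite exprS -/(X k); lra.
have nN : dec (enc (Nn k) n) = n.
  apply: encK; apply: (@intr_norm_le R _ (1 + 2 * D * X k * M k)); last first.
    by rewrite natr1 /Nn (lt_trans (truncnS_gt _)) // ltr_nat.
  have -> : n%:~R = (n%:~R + \sum_j (m ord0 j)%:~R * x ord0 j) - \sum_j (m ord0 j)%:~R * x ord0 j.
    by rewrite addrK.
  apply: le_trans (ler_normB _ _) _; apply: lerD.
    by apply: le_trans hx _; rewrite -[leRHS](powRr0 (X k)) ler_powR // oppr_le0 ltW.
  apply: le_trans (ler_norm_sum _ _ _) _.
  apply: (@le_trans _ _ (\sum_(j < d.+1) 2 * X k * M k)).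
    apply: ler_sum => j _; rewrite normrM ler_pM //.
    by apply: le_trans (m3 j) _; rewrite /X -exprS ltW.
  by rewrite sumr_const card_ord -mulr_natr -/D le_eqVlt; apply/orP; left; apply/eqP; ring.
pose z j := Num.floor (x ord0 (lift i j) / h k).
have zG j : dec (enc (G k) (z j)) = z j.
  have hz := floor_itv (x ord0 (lift i j) / h k); rewrite -/(z j) in hz.
  have : `|x ord0 (lift i j) / h k| <= M k / h k.
    by rewrite normrM normfV (gtr0_norm (h0 k)) ler_wpM2r // invr_ge0 ltW.
  move=> hz'; apply: encK; apply: (@intr_norm_le R _ (M k / h k + 1)).
    move: hz hz'; rewrite intrD !ler_norml => /andP[? ?] /andP[? ?].
    by apply/andP; split; lra.
  rewrite /G -natr1 -addrA ltr_leD //.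
    by apply: lt_le_trans (truncnS_gt _) _.
  lra.
exists (i, [ffun j => enc (L k) (m ord0 j)], enc (Nn k) n, [ffun j => enc (G k) (z j)]).
split; rewrite /= ?ffunE ?mL ?nN //.
- by move=> j; rewrite ffunE mL.
- by under eq_bigr do rewrite ffunE mL.
move=> j; rewrite ffunE zG.
have /andP[f1 f2] := floor_itv (x ord0 (lift i j) / h k).
move: f1 f2; rewrite -/(z j) intrD ler_pdivlMr // ltr_pdivrMr // => f1 f2.
by rewrite ler_norml; apply/andP; split; have := h0 k; lra.
Qed.

End SlabLimsup.

(** * Upper bound for the dimension *)

Lemma finite_gap (R : realDomainType) (T : finType) (P : T -> R -> Prop) :
  (forall t, exists2 e, 0 < e & P t e) ->
  (forall t e e', e' <= e -> P t e -> P t e') ->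
  exists2 e, 0 < e & forall t, P t e.
Proof.
move=> h mono.
have h' : forall t, exists e, 0 < e /\ P t e by move=> t; have [e] := h t; exists e.
have [f hf] := choice h'.
exists (\big[Num.min/1]_t f t).
  by elim/big_rec: _ => // t x _ x0; rewrite lt_min (hf t).1.
by move=> t; apply: mono (hf t).2; rewrite (bigD1 t) //= ge_min lexx.
Qed.

Lemma int_translate_gap (R : realType) (v : R) : (forall n : int, n%:~R + v != 0) ->
  exists2 e, 0 < e & forall n : int, e <= `|n%:~R + v|.
Proof.
move=> hv; pose f := v - (Num.floor v)%:~R.
have /andP[f1 f2] := floor_itv v.
have f0 : 0 < f.
  by rewrite lt_neqAle eq_sym subr_ge0 f1 andbT /f addrC -rmorphN /= hv.
have f3 : 0 < 1 - f by move: f2; rewrite intrD /f; lra.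
exists (Num.min f (1 - f)); first by rewrite lt_min f0.
move=> n; have [h|h] := leP 0 (n + Num.floor v).
  have : 0 <= (n + Num.floor v)%:~R :> R by rewrite ler0z.
  rewrite intrD => h'; rewrite ge_min; apply/orP; left.
  by apply: le_trans (ler_norm _); rewrite /f; lra.
have : (n + Num.floor v + 1)%:~R <= 0 :> R by rewrite lerz0; lia.
rewrite !intrD => h'; rewrite ge_min; apply/orP; right.
by rewrite -normrN; apply: le_trans (ler_norm _); rewrite /f; lra.
Qed.

Section Upper.
Variable R : realType.

Lemma Kset_int_eq0 d (a : 'rV[R]_d) (n : int) (m : 'rV[int]_d) : Kset a ->
  n%:~R + \sum_j (m ord0 j)%:~R * a ord0 j = 0 -> m = 0.
Proof.
move=> aK h; have [|_ h'] := aK n%:~R (fun j => (m ord0 j)%:~R).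
  rewrite ratr_int -[RHS]h; congr (_ + _); apply: eq_bigr => j _.
  by rewrite ratr_int.
by apply/rowP => j; rewrite mxE; apply/eqP; rewrite -(intr_eq0 rat); apply/eqP; exact: h'.
Qed.

(** For each of the finitely many [m], all [n] are handled at once by the distance of [m.a] to the
    integers, positive because [a] lies in [Kset]. The gap is what forces the vectors of
    [hole_dual_approx] to be long. *)
Lemma dual_gap d (a : 'rV[R]_d) (L : nat) : Kset a ->
  exists2 e : R, 0 < e & forall (n : int) (m : 'rV[int]_d), m != 0 ->
    (forall j, `|m ord0 j| <= L%:Z) -> e <= `|n%:~R + \sum_j (m ord0 j)%:~R * a ord0 j|.
Proof.
move=> aK.
have [||e e0 he] := @finite_gap R {ffun 'I_d -> 'I_(2 * L).+1}
  (fun c e => forall (n : int) (m : 'rV[int]_d), m != 0 ->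
    (forall j, m ord0 j = dec (c j)) -> e <= `|n%:~R + \sum_j (m ord0 j)%:~R * a ord0 j|).
- move=> c; pose m : 'rV[int]_d := \row_j dec (c j).
  have mE (m' : 'rV[int]_d) : (forall j, m' ord0 j = dec (c j)) -> m' = m.
    by move=> h; apply/rowP => j; rewrite mxE.
  have [m0|m0] := eqVneq m 0.
    by exists 1 => // n m' m'0 /mE m'E; move: m'0; rewrite m'E m0 eqxx.
  have [|e e0 he] := @int_translate_gap R (\sum_j (m ord0 j)%:~R * a ord0 j).
    by move=> n; apply: contra m0 => /eqP/(Kset_int_eq0 aK) ->.
  by exists e => // n m' _ /mE ->.
- by move=> c e e' ee h n m m0 mc; apply: le_trans ee _; exact: h.
exists e => // n m m0 mL; apply: (he [ffun j => enc L (m ord0 j)]) => // j.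
by rewrite ffunE encK.
Qed.

(** Taking [C / Q] below the gap of [dual_gap] forces a coordinate of [m] beyond [2^K1]. With
    [X = 2^k <= |m_i| <= C Q^eta], the bound [C / Q] becomes [C * C^w0 * X^(- w0)], and passing from
    [w0] to [w] absorbs the constant. *)
Lemma exceptional_slab d (eta w : R) (a : 'rV[R]_d.+1) : 0 < eta -> eta < 1 -> w < 1 / eta ->
  ~ Dset eta a -> Kset a ->
  forall k0, exists k, (k0 <= k)%N /\ exists n m i, slab w k a n m i.
Proof.
move=> eta0 eta1 ww aD aK k0.
have [C C0 hC] := hole_dual_approx eta0 (ltW eta1) (notin_Dset_hole (ltn0Sn d) aD).
set w0 := 1 / eta in ww.
have ww0 : 0 < w0 - w by rewrite subr_gt0.
have w00 : 0 < w0 by rewrite divr_gt0.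
have [N1 _ hN1] := powR_unbounded (C * C `^ w0) ww0.
pose K1 := maxn k0 N1.
have [e e0 he] := @dual_gap _ a (2 ^ K1) aK.
pose e' := Num.min e 1.
have e'0 : 0 < e' by rewrite lt_min e0 ltr01.
pose Q := 2 * C / e'.
have Q0 : 0 < Q by rewrite divr_gt0 // mulr_gt0.
have CQ : C / Q = e' / 2 by rewrite /Q; field; rewrite !gt_eqF.
have [n [m [nm [h1 h2]]]] := hC Q Q0.
have e'e : e' <= e /\ e' <= 1 by rewrite /e' !ge_min !lexx orbT.
have m0 : m != 0.
  apply: contraT => /negPn/eqP m0; move: nm; rewrite m0 eqxx orbF => n0.
  have : 1 <= `|n%:~R : R| by rewrite -intr_norm ler1z -gtz0_ge1 normr_gt0.
  move: h1; rewrite m0 big1 ?addr0; last by move=> i _; rewrite mxE mul0r.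
  rewrite CQ => h3 h4; have [_ h5] := e'e; by suff : False by []; lra.
have card_gt0 : (0 < #|'I_d.+1|)%N by rewrite card_ord.
have [i hi] := @bigop.eq_bigmax _ (fun j => absz (m ord0 j)) card_gt0.
have him j : (absz (m ord0 j) <= absz (m ord0 i))%N.
  by rewrite -hi; exact: (@bigop.leq_bigmax _ (fun j => absz (m ord0 j))).
set H := absz (m ord0 i) in hi him.
have HE : `|(m ord0 i)%:~R| = H%:R :> R by rewrite -intr_norm pmulrn abszE.
have LH : (2 ^ K1 < H)%N.
  rewrite ltnNge; apply/negP => HL.
  have := he n m m0; rewrite leNgt => /(_ _)/negP; apply.
    by move=> j; rewrite -abszE lez_nat (leq_trans (him j) HL).
  by apply: le_lt_trans h1 _; rewrite CQ; lra.
have H0 : (0 < H)%N by apply: leq_ltn_trans LH.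
pose k := trunc_log 2 H.
have k1 : (2 ^ k <= H)%N by apply: trunc_logP.
have k2 : (H < 2 ^ k.+1)%N by apply: trunc_log_ltn.
have Kk : (K1 <= k)%N by apply: trunc_log_max => //; exact: ltnW.
exists k; split; first by apply: leq_trans Kk; rewrite leq_maxl.
exists n, m, i; split.
- by rewrite HE -natrX ler_nat.
- by rewrite HE -natrX ltr_nat.
- move=> j; by rewrite HE -intr_norm pmulrn ler_int abszE lez_nat; exact: him.
apply: le_trans h1 _.
set X : R := 2 ^+ k.
have X0 : 0 < X by rewrite exprn_gt0.
have XQ : X <= C * Q `^ eta.
  by apply: le_trans (h2 i); rewrite HE /X -natrX ler_nat.
have XQ' : X `^ w0 <= C `^ w0 * Q.
  have -> : C `^ w0 * Q = (C * Q `^ eta) `^ w0.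
    rewrite powRM ?powR_ge0 ?(ltW C0) // -powRrM /w0 mul1r mulfV ?gt_eqF //.
    by rewrite powRr1 // ltW.
  by apply: ge0_ler_powR; rewrite ?nnegrE ?(ltW w00) ?(ltW X0) ?mulr_ge0 ?powR_ge0 ?(ltW C0).
have XN : C * C `^ w0 <= X `^ (w0 - w).
  apply: hN1; rewrite /X -natrX ler_nat; apply: (@leq_trans k).
    by apply: leq_trans Kk; rewrite leq_maxr.
  by rewrite ltnW // ltn_expl.
rewrite ler_pdivrMr // -(ler_pM2l (powR_gt0 w0 C0)).
apply: (@le_trans _ _ (X `^ (- w) * X `^ w0)); last first.
  by rewrite mulrCA ler_wpM2l ?powR_ge0.
rewrite -powRD; last by rewrite (gt_eqF X0) implybT.
by rewrite [- w + w0]addrC mulrC.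
Qed.

Lemma hdim_exceptional_le (d : nat) (eta : R) : 0 < eta -> eta < 1 / d%:R -> (2 <= d)%N ->
  (hdim (~` (@Dset R d eta) `&` @Kset R d) <=
        (d%:R - 2 + (2 * (d%:R + 1) * ((1 + eta) * d%:R - 1))
                    / ((1 + eta) * d%:R ^+ 2))%:E)%E.
Proof.
case: d => [|d] // eta0 eta1 d2.
pose D : R := d.+1%:R.
have D2 : 2 <= D by rewrite (ler_nat _ 2).
have eD : 0 < 1 - D * eta.
  by move: eta1; rewrite ltr_pdivlMr -/D; [lra|rewrite /D ltr0n].
have eta11 : eta < 1 by nra.
rewrite -/D.
set s := D - 2 + _.
(* The slabs allow any dimension above [D - x], while the target is [s = D - 2 x / D^2], strictly
   larger because [D^2 >= 4]. This margin leaves room for [w]. *)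
pose x := (1 - D * eta) / (1 + eta).
have x0 : 0 < x by rewrite divr_gt0 //; lra.
have sE : s = D - 2 * x / D ^+ 2.
  by rewrite /s /x; field; apply/andP; split; apply: lt0r_neq0; lra.
pose sg := 1 - 2 * x / D ^+ 2.
have DE : D = d%:R + 1 by rewrite /D natr1.
have sg1 : s - d%:R = sg by rewrite sE /sg DE; ring.
have xE : x = 1 - (D + 1) * (eta / (1 + eta)).
  by rewrite /x; field; apply: lt0r_neq0; lra.
have D4 : 4 <= D ^+ 2 by nra.
have xD : 2 * x / D ^+ 2 <= x / 2.
  rewrite ler_pdivrMr; last lra.
  nra.
have xD0 : 0 <= 2 * x / D ^+ 2 by rewrite divr_ge0 ?sqr_ge0 //; lra.
have q0 : 0 < eta / (1 + eta) by rewrite divr_gt0 //; lra.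
have sgq : (D + 1) * (eta / (1 + eta)) < sg.
  have -> : (D + 1) * (eta / (1 + eta)) = 1 - x by rewrite xE; ring.
  rewrite /sg ltrD2l ltrN2; apply: le_lt_trans xD _.
  by rewrite ltr_pdivrMr // ltr_pMr // ltr1n.
have sg0 : 0 < sg by apply: lt_trans sgq; rewrite mulr_gt0 //; lra.
have key : (D + 1) / sg < 1 + 1 / eta.
  have -> : 1 + 1 / eta = (eta / (1 + eta))^-1.
    by field; apply/andP; split; apply: lt0r_neq0; lra.
  by rewrite ltr_pdivrMr // mulrC ltr_pdivlMr.
have key2 : D + 1 <= (D + 1) / sg.
  by rewrite ler_pdivlMr // ler_piMr ?/sg ?gerBl //; lra.
(* Midpoint between the value with [(1 + w) * sg = D + 1], which the slab lemma needs exceeded, and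
   [1 / eta], below which [exceptional_slab] applies. *)
pose w := ((D + 1) / sg - 1 + 1 / eta) / 2.
have x1 : x <= 1 by rewrite xE gerBl mulr_ge0 ?(ltW q0) //; lra.
have s0 : 0 <= s by rewrite sE subr_ge0; apply: le_trans xD _; lra.
apply: ereal_inf_lbound; exists s => //; split => //.
apply: (@slab_limsup_hmeasure0 R d w).
- rewrite /w; lra.
- exact: s0.
- rewrite sg1.
  have : (D + 1) / sg * sg < (1 + w) * sg.
    have gen (P I : R) : P < 1 + I -> P < 1 + (P - 1 + I) / 2 by lra.
    by rewrite ltr_pM2r //; exact: gen.
  by rewrite divfK ?gt_eqF // => h; apply: le_lt_trans h; rewrite DE; lra.
move=> a [aD aK]; apply: (@exceptional_slab _ eta) => //.
have gen (P I : R) : P < 1 + I -> (P - 1 + I) / 2 < I by lra.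
exact: gen.
Qed.

End Upper.

(** * Counting and spacing of rational points *)

Lemma denq_le (q : rat) (M : nat) (N : int) : (0 < M)%N -> q * M%:R = N%:~R -> denq q <= M%:Z.
Proof.
move=> M0 h.
have d0 := denq_gt0 q.
have e : numq q * M%:Z = N * denq q.
  apply/eqP; rewrite -(eqr_int rat) !rmorphM /= numqE -h -pmulrn.
  by rewrite mulrAC.
have : (`|denq q| %| M)%N.
  rewrite -(@Gauss_dvdr _ `|numq q|%N); last by rewrite coprime_sym coprime_num_den.
  by rewrite -[M]/(absz M%:Z) -abszM e abszM dvdn_mull.
by move=> /(dvdn_leq M0); lia.
Qed.

(** A pair that is not coprime is counted at [g] equal to its gcd, and exactly [(B / g)^2] pairs are
    divisible by [g]. The sum of [1 / g^2] over [g >= 2] stays below 3/4 by telescoping, so a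
    quarter of the pairs remains. *)
Lemma coprime_pairs (B : nat) :
  (B ^ 2 <= 4 * #|[set p : 'I_B * 'I_B | coprime p.1.+1 p.2.+1]%SET|)%N.
Proof.
have cnt g : (0 < g)%N -> (\sum_(i < B) (g %| i.+1) = B %/ g)%N.
  move=> g0; elim: (B) => [|n IH]; first by rewrite big_ord0 div0n.
  by rewrite big_ord_recr /= IH divnS // addnC.
have h1 : (B ^ 2 <= #|[set p : 'I_B * 'I_B | coprime p.1.+1 p.2.+1]%SET| +
    \sum_(2 <= g < B.+1) (B %/ g) ^ 2)%N.
  have -> : (\sum_(2 <= g < B.+1) (B %/ g) ^ 2 =
     \sum_(p : 'I_B * 'I_B) \sum_(2 <= g < B.+1) ((g %| p.1.+1) * (g %| p.2.+1)))%N.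
    rewrite exchange_big /= big_nat_cond [RHS]big_nat_cond; apply: eq_bigr => g /andP[/andP[g2 _] _].
    rewrite -(pair_bigA _ (fun i j : 'I_B => (g %| i.+1) * (g %| j.+1)))%N /=.
    rewrite expnS expn1 -cnt ?(leq_trans _ g2) // big_distrl /=; apply: eq_bigr => i _.
    by rewrite big_distrr.
  rewrite -sum1_card [X in (_ <= X + _)%N]big_mkcond /= -big_split /=.
  have -> : (B ^ 2 = \sum_(p : 'I_B * 'I_B) 1)%N by rewrite sum1_card card_prod card_ord expnS expn1.
  apply: leq_sum => p _; rewrite inE; case: ifP => // /negbT ncop.
  set g := gcdn p.1.+1 p.2.+1.
  have g0 : (0 < g)%N by rewrite gcdn_gt0.
  have g1 : (g != 1)%N by [].
  have gB : (g <= B)%N.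
    by apply: leq_trans (ltn_ord p.1); apply: dvdn_leq => //; exact: dvdn_gcdl.
  rewrite add0n (bigD1_seq g) ?iota_uniq //=; last by rewrite mem_index_iota; lia.
  by rewrite dvdn_gcdl dvdn_gcdr.
have h2 : (4 * \sum_(2 <= g < B.+1) (B %/ g) ^ 2 <= 3 * B ^ 2)%N.
  have [B2|B2] := ltnP B 2; first by rewrite big_geq.
  have sq n : (2 <= n)%N -> \sum_(2 <= g < n.+1) (1 / (g%:R ^+ 2) : rat) <= 3 / 4 - 1 / n%:R.
    elim: n => // n IH; rewrite leq_eqVlt => /orP[/eqP <-|].
      by rewrite big_nat1; lra.
    rewrite ltnS => n2; rewrite big_nat_recr //=; last by rewrite ltnW.
    apply: le_trans (lerD (IH n2) (lexx _)) _.
    have n0 : 0 < n%:R :> rat by rewrite ltr0n; lia.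
    have -> : 3 / 4 - 1 / n%:R + 1 / n.+1%:R ^+ 2 =
       3 / 4 - 1 / n.+1%:R - 1 / (n%:R * n.+1%:R ^+ 2) :> rat.
      rewrite -natr1; field; apply/andP; split; apply: lt0r_neq0; lra.
    by rewrite gerBl divr_ge0 // mulr_ge0 ?sqr_ge0 // ltW.
  rewrite -(ler_nat rat) [leLHS]natrM [leRHS]natrM natr_sum [(B ^ 2)%:R]natrX.
  have B0 : 0 < B%:R :> rat by rewrite ltr0n; lia.
  apply: (@le_trans _ _ (4 * (B%:R ^+ 2 * \sum_(2 <= g < B.+1) (1 / (g%:R ^+ 2) : rat)))).
    rewrite ler_wpM2l // mulr_sumr [leLHS]big_nat_cond [leRHS]big_nat_cond; apply: ler_sum => g /andP[/andP[g2 _] _].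
    have g0 : 0 < g%:R :> rat by rewrite ltr0n; lia.
    rewrite mulrA mulr1 -expr_div_n natrX lerXn2r ?nnegrE ?divr_ge0 ?ler0n //.
    by rewrite ler_pdivlMr // -natrM ler_nat leq_trunc_div.
  have := sq B B2; set S := \sum_(2 <= g < B.+1) _ => hS.
  have hS' : S <= 3 / 4 by apply: le_trans hS _; rewrite gerBl divr_ge0.
  have : B%:R ^+ 2 * S <= B%:R ^+ 2 * (3 / 4) by rewrite ler_wpM2l ?sqr_ge0.
  lra.
lia.
Qed.

Lemma spaced_count (R : realType) (T : finType) (f : T -> R) (sg L : R) (A : {set T}) :
  0 < sg -> 0 <= L ->
  (forall x y, x \in A -> y \in A -> x != y -> sg <= `|f x - f y|) ->
  (forall x y, x \in A -> y \in A -> `|f x - f y| <= L) ->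
  #|A|%:R <= 3 + 2 * (L / sg).
Proof.
move=> sg0 L0 h1 h2.
have Lsg : 0 <= L / sg by rewrite divr_ge0 // ltW.
have [->|/set0Pn[x0 x0A]] := eqVneq A (finset.set0); first by rewrite cards0; lra.
pose G := (Num.truncn (L / sg)).+1.
pose z x := Num.floor ((f x - f x0) / sg).
have zG x : x \in A -> dec (enc G (z x)) = z x.
  move=> xA; apply: encK; apply: (@intr_norm_le R _ (L / sg + 1)).
    have := floor_itv ((f x - f x0) / sg); rewrite -/(z x) intrD => /andP[z1 z2].
    have : `|(f x - f x0) / sg| <= L / sg.
      by rewrite normrM normfV (gtr0_norm sg0) ler_wpM2r ?invr_ge0 ?h2 // ltW.
    by rewrite !ler_norml => /andP[? ?]; apply/andP; split; lra.
  by rewrite ltrD2r /G truncnS_gt.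
have inj : {in A &, injective (fun x => enc G (z x))}.
  move=> x y xA yA /(congr1 (@dec G)); rewrite !zG // => zxy.
  apply/eqP; apply: contraT => xy; have := h1 x y xA yA xy.
  rewrite leNgt => /negP; case.
  have := floor_itv ((f x - f x0) / sg); have := floor_itv ((f y - f x0) / sg).
  rewrite -/(z x) -/(z y) zxy intrD => /andP[z1 z2] /andP[z3 z4].
  have : `|(f x - f x0) / sg - (f y - f x0) / sg| < 1.
    by rewrite ltr_norml; apply/andP; split; lra.
  rewrite -mulrBl normrM normfV (gtr0_norm sg0) ltr_pdivrMr // mul1r.
  by rewrite opprB addrA subrK.
have : (#|A| <= (2 * G).+1)%N.
  by rewrite -(card_in_imset inj) -[leqRHS]card_ord max_card.
rewrite -(ler_nat R) => /le_trans; apply.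
rewrite -natr1 natrM /G -natr1.
have : (Num.truncn (L / sg))%:R <= L / sg by rewrite truncn_le.
lra.
Qed.

Lemma nested_intervals (R : realType) (u v : nat -> R) :
  (forall n, u n <= u n.+1) -> (forall n, v n.+1 <= v n) -> (forall n, u n <= v n) ->
  exists x, forall n, u n <= x <= v n.
Proof.
move=> hu hv uv.
have mu m n : (m <= n)%N -> u m <= u n.
  elim: n => [|n IH]; first by rewrite leqn0 => /eqP ->.
  by rewrite leq_eqVlt => /orP[/eqP ->//|]; rewrite ltnS => /IH /le_trans; apply.
have mv m n : (m <= n)%N -> v n <= v m.
  elim: n => [|n IH]; first by rewrite leqn0 => /eqP ->.
  by rewrite leq_eqVlt => /orP[/eqP ->//|]; rewrite ltnS => /IH; apply: le_trans.
have ub n : ubound (range u) (v n).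
  move=> _ [m _ <-]; have [mn|nm] := leqP m n.
    exact: le_trans (mu _ _ mn) (uv n).
  exact: le_trans (uv m) (mv _ _ (ltnW nm)).
exists (sup (range u)) => n; apply/andP; split.
  by apply: ub_le_sup; [exists (v 0%N); exact: ub|exists n].
by apply: ge_sup => //; exists (u 0%N), 0%N.
Qed.

Lemma term_le_nneseries (R : realType) (u : nat -> \bar R) n : (forall i, 0 <= u i)%E ->
  (u n <= \sum_(0 <= i <oo) u i)%E.
Proof.
move=> u0; apply: (@le_trans _ _ (\sum_(0 <= i < n.+1) u i)%E).
  by rewrite big_nat_recr //= leeDr // sume_ge0.
exact: nneseries_lim_ge.
Qed.

(** * Approximable points that avoid a cover *)

Section Avoid.
Variables (R : realType) (s w : R) (F : nat -> set R) (r : nat -> R).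
Hypotheses (s0 : 0 < s) (s1 : s < 1) (w1 : 1 <= w) (sw : (1 + w) * s < 2).
Hypothesis r0 : forall n, 0 < r n.
Hypothesis Fr : forall n x y, F n x -> F n y -> `|x - y| <= r n.

Definition segment (z : rat) (k : nat) := [set x : R | ratr z <= x <= ratr z + k%:R^-1].

Definition touch (J : set R) n : R := (`[< exists x, F n x /\ J x >])%:R.

Definition load (J : set R) : \bar R := \sum_(0 <= n <oo) (touch J n * r n `^ s)%:E.

Let c : R := 1 / 64.

Lemma touch_ge0 J n : 0 <= touch J n. Proof. exact: ler0n. Qed.

Lemma touch_sub J J' n : J `<=` J' -> touch J n <= touch J' n.
Proof.
move=> JJ; rewrite /touch ler_nat; case: asboolP => // -[x [Fx Jx]].
by case: asboolP => // h; exfalso; apply: h; exists x; split => //; exact: JJ.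
Qed.

Lemma touch1 J n x : F n x -> J x -> touch J n = 1.
Proof. by move=> Fx Jx; rewrite /touch; case: asboolP => // h; exfalso; apply: h; exists x. Qed.

Lemma load_term_ge0 J n : (0 <= (touch J n * r n `^ s)%:E)%E.
Proof. by rewrite lee_fin mulr_ge0 ?touch_ge0 ?powR_ge0. Qed.

Section Children.
Variables (z : rat) (k B : nat).
Hypotheses (k0 : (0 < k)%N) (B0 : (0 < B)%N).
Implicit Types p q : 'I_B * 'I_B.

Let b : R := B%:R.
Let kR : R := k%:R.
Let D : R := (denq z)%:~R.

(** Coprime pairs give distinct reduced fractions [a / (a + a')] in (0, 1) of denominator at most
    [2 B]: at least [B^2 / 4] of them, at mutual distance at least [1 / (4 B^2)]. *)
Definition child p : rat := z + p.1.+1%:R / (p.1.+1 + p.2.+1)%:R / k%:R.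

Let b1 : 1 <= b. Proof. by rewrite ler1n. Qed.
Let k1 : 1 <= kR. Proof. by rewrite ler1n. Qed.
Let D1 : 1 <= D. Proof. by rewrite ler1z -gtz0_ge1 denq_gt0. Qed.

Lemma childE p : ratr (child p) = ratr z + p.1.+1%:R / (p.1.+1 + p.2.+1)%:R / kR.
Proof. by rewrite rmorphD !rmorphM /= !fmorphV /= !ratr_nat. Qed.

Lemma child_den_le p : (p.1.+1 + p.2.+1)%:R <= 2 * b.
Proof.
rewrite /b -natrM ler_nat mul2n -addnn; apply: leq_add; exact: ltn_ord.
Qed.

Lemma denq_child_le p : (denq (child p))%:~R <= 2 * b * kR * D.
Proof.
pose M := (`|denq z| * k * (p.1.+1 + p.2.+1))%N.
have M0 : (0 < M)%N by rewrite !muln_gt0 absz_gt0 denq_neq0 k0.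
have h : child p * M%:R = (numq z * k%:Z * (p.1.+1 + p.2.+1)%:Z + p.1.+1%:Z * denq z)%:~R.
  rewrite rmorphD !rmorphM /= numqE -!pmulrn /child.
  have -> : (`|denq z|%N%:R : rat) = (denq z)%:~R by rewrite pmulrn gtz0_abs ?denq_gt0.
  have S0 : (p.1.+1 + p.2.+1)%:R != 0 :> rat by rewrite pnatr_eq0 addn_eq0.
  have K0 : k%:R != 0 :> rat by rewrite pnatr_eq0 -lt0n.
  move: (p.1.+1 + p.2.+1)%:R k%:R S0 K0 => S K S0 K0.
  by field; rewrite S0 K0.
have := denq_le M0 h; rewrite -(ler_int R) => /le_trans; apply.
rewrite -pmulrn /M !natrM.
have -> : (`|denq z|%N%:R : R) = D by rewrite pmulrn gtz0_abs ?denq_gt0.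
rewrite -/kR [leRHS](_ : _ = D * kR * (2 * b)); last by ring.
by rewrite ler_wpM2l ?child_den_le // mulr_ge0 ?(le_trans ler01 D1) ?(le_trans ler01 k1).
Qed.

Lemma child_spaced p q : coprime p.1.+1 p.2.+1 -> coprime q.1.+1 q.2.+1 -> p != q ->
  (4 * b ^+ 2 * kR)^-1 <= `|ratr (child p) - ratr (child q)| :> R.
Proof.
case: p q => [a a'] [e e'] /= cp cq pq; rewrite !childE /=.
pose N : int := a.+1%:Z * e'.+1%:Z - e.+1%:Z * a'.+1%:Z.
have N0 : N != 0.
  apply: contra pq; rewrite subr_eq0 => h'.
  have h : (a.+1 * e'.+1 = e.+1 * a'.+1)%N by apply/eqP; rewrite -eqz_nat !PoszM.
  have ae : a.+1 = e.+1.
    apply/eqP; rewrite eqn_dvd; apply/andP; split.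
      by rewrite -(Gauss_dvdl _ cp) -h dvdn_mulr.
    by rewrite -(Gauss_dvdl _ cq) h dvdn_mulr.
  have ae' : a'.+1 = e'.+1.
    by have := esym h; rewrite ae => /eqP; rewrite eqn_pmul2l // => /eqP.
  by rewrite xpair_eqE -!val_eqE /=; apply/andP; split; apply/eqP; [case: ae|case: ae'].
set S : R := (a.+1 + a'.+1)%:R; set S' : R := (e.+1 + e'.+1)%:R.
have Sp : 0 < S by rewrite ltr0n addn_gt0.
have S'p : 0 < S' by rewrite ltr0n addn_gt0.
have Sb : S <= 2 * b by exact: (child_den_le (a, a')).
have S'b : S' <= 2 * b by exact: (child_den_le (e, e')).
have kp : 0 < kR by exact: lt_le_trans k1.
have bp : 0 < b by exact: lt_le_trans b1.
have -> : ratr z + a.+1%:R / S / kR - (ratr z + e.+1%:R / S' / kR) = N%:~R / (S * S' * kR).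
  rewrite /N rmorphB !rmorphM /= -!pmulrn.
  have SE : S = a.+1%:R + a'.+1%:R by rewrite /S natrD.
  have S'E : S' = e.+1%:R + e'.+1%:R by rewrite /S' natrD.
  rewrite [X in X = _](_ : _ = (a.+1%:R * S' - e.+1%:R * S) / (S * S' * kR)); last first.
    by field; rewrite !gt_eqF.
  by congr (_ / _); rewrite SE S'E; ring.
have P0 : 0 < S * S' * kR by rewrite !mulr_gt0.
rewrite normrM normfV (gtr0_norm P0) -intr_norm.
have N1 : 1 <= `|N|%:~R :> R by rewrite ler1z -gtz0_ge1 normr_gt0.
apply: (@le_trans _ _ (1 / (S * S' * kR))); last by rewrite ler_wpM2r // invr_ge0 ltW.
rewrite mul1r lef_pV2 ?posrE //; last by rewrite !mulr_gt0 ?exprn_gt0.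
rewrite ler_wpM2r ?(ltW kp) //.
have -> : 4 * b ^+ 2 = (2 * b) * (2 * b) by ring.
by apply: ler_pM => //; exact: ltW.
Qed.

End Children.

(** The invariant of the nested construction. In particular a set [F n] meeting a light segment has
    [r n] below the length of the segment. *)
Variant light (z : rat) (k : nat) : Prop :=
  Light of (load (segment z k) < (c * k%:R `^ (- s))%:E)%E.

(** An average over the children of coprime pairs. Approximation requires children of length about
    [(2 B k D)^(-(1 + w))], so that the weighted loads add up to a term of order [B^((1 + w) * s)]
    plus [B^2 / 8]. As [(1 + w) * s < 2], for large [B] this is less than the number of children,
    and some child has weighted load below 1. *)
Lemma segment_refine (z : rat) (k : nat) (p0 : R) : (0 < k)%N ->
  light z k ->
  exists (z' : rat) (k' : nat), [/\ (2 * k <= k')%N, segment z' k' `<=` segment z k,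
    ~ segment z' k' p0, light z' k' &
    k'%:R^-1 <= (denq z')%:~R `^ (- (1 + w)) :> R].
Proof.
move=> k0 hload.
move: (s0) (s1) (w1) (sw) => s0' s1' w1' sw'.
set D : R := (denq z)%:~R; set kR : R := k%:R.
have D1 : 1 <= D by rewrite ler1z -gtz0_ge1 denq_gt0.
have k1 : 1 <= kR by rewrite ler1n.
pose E := (2 * kR * D) `^ ((1 + w) * s).
have E0 : 0 <= E by exact: powR_ge0.
have g0 : 0 < 2 - (1 + w) * s by rewrite subr_gt0.
(* [E] collects what does not depend on [B]. The choice yields [14 E B^((1 + w) s) + 5 < B^2 / 8];
   the load constant 1/64 yields another [B^2 / 8], and the total stays below [B^2 / 4 <= #|C|]. *)
have [B B0 hB] := powR_unbounded (8 * (14 * E + 6)) g0.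
pose b : R := B%:R.
have b1 : 1 <= b by rewrite ler1n.
have {}hB : 8 * (14 * E + 6) <= b `^ (2 - (1 + w) * s) by exact: hB.
pose U := 2 * b * kR * D.
have U2 : 2 * b * kR <= U by rewrite /U ler_peMr // mulr_ge0 //; lra.
have U3 : 2 * kR <= 2 * b * kR by rewrite ler_wpM2r //; lra.
have U1 : 1 <= U by lra.
have U0 : 0 <= U by lra.
pose Y := U `^ (1 + w).
have UY : U <= Y by apply: le1r_powR => //; lra.
pose k' := (Num.truncn Y).+1; pose k'R : R := k'%:R.
have Yk' : Y <= k'R by rewrite /k'R ltW // truncnS_gt.
have k'Y : k'R <= 2 * Y.
  have : (Num.truncn Y)%:R <= Y by rewrite truncn_le; lra.
  by rewrite /k'R /k' -natr1; lra.
have k'1 : 1 <= k'R by lra.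
have k'0 : 0 < k'R by lra.
have kR0 : 0 < kR by lra.
pose sg := (4 * b ^+ 2 * kR)^-1.
have b20 : 0 < b ^+ 2 by rewrite exprn_gt0 //; lra.
have q0 : 0 < 4 * b ^+ 2 * kR by rewrite mulr_gt0 // mulr_gt0 //.
have sg0 : 0 < sg by rewrite invr_gt0.
have k'sg : k'R^-1 <= sg.
  rewrite lef_pV2 ?posrE //; apply: le_trans Yk'.
  apply: (@le_trans _ _ (U ^+ 2)).
    have -> : U ^+ 2 = (4 * b ^+ 2 * kR) * (kR * D ^+ 2) by rewrite /U; ring.
    by rewrite ler_peMr ?(ltW q0) // mulr_ege1 // exprn_ege1.
  by rewrite -powR_mulrn // ler_powR //; lra.
pose C := [set p : 'I_B * 'I_B | coprime p.1.+1 p.2.+1]%SET.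
pose J p := segment (@child z k B p) k'.
have JI p : J p `<=` segment z k.
  move=> x; rewrite /J /segment /= childE -/kR -/k'R => /andP[x1 x2].
  set S : R := (p.1.+1 + p.2.+1)%:R in x1 x2.
  have Sp : 0 < S by rewrite ltr0n addn_gt0.
  have Sb : S <= 2 * b by exact: child_den_le.
  have f0 : 0 <= p.1.+1%:R / S / kR by rewrite !divr_ge0 // ltW.
  have f1 : p.1.+1%:R / S <= 1 - (2 * b)^-1.
    have -> : p.1.+1%:R / S = 1 - p.2.+1%:R / S.
      have SE : p.1.+1%:R = S - p.2.+1%:R by rewrite /S natrD addrK.
      by rewrite SE; field; rewrite gt_eqF.
    rewrite lerD2l lerN2; apply: (@le_trans _ _ S^-1).
      rewrite lef_pV2 ?posrE //; lra.
    by rewrite ler_peMl ?invr_ge0 ?(ltW Sp) // ler1n.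
  have f2 : p.1.+1%:R / S / kR <= kR^-1 - k'R^-1.
    apply: (@le_trans _ _ ((1 - (2 * b)^-1) / kR)).
      by rewrite ler_wpM2r // invr_ge0 ltW.
    rewrite mulrBl mul1r lerD2l lerN2 -invfM lef_pV2 ?posrE ?mulr_gt0 //; lra.
  by apply/andP; split; lra.
(* Children meeting a set of diameter [rho] have left endpoints within [rho + 1 / k'] of each other,
   and [1 / k' <= sg]; hence the bound [3 + 2 (rho / sg + 1)]. *)
have count (A : set R) (rho : R) : 0 <= rho -> (forall x y, A x -> A y -> `|x - y| <= rho) ->
    \sum_(p in C) ((`[< exists x, A x /\ J p x >])%:R : R) <= 5 + 2 * rho / sg.
  move=> rho0 hA.
  rewrite -natr_sum -big_mkcondr /= sum1_card.
  have := @spaced_count R _ (fun p => ratr (@child z k B p)) sg (rho + k'R^-1)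
    [set p in C | `[< exists x, A x /\ J p x >]]%SET sg0.
  rewrite cardsE => h.
  apply: le_trans (h _ _ _) _.
  - by rewrite addr_ge0 // invr_ge0 ltW.
  - move=> p q; rewrite !inE => /andP[cp _] /andP[cq _] pq.
    exact: child_spaced.
  - move=> p q; rewrite !inE => /andP[_ /asboolP[x [Ax /andP[x1 x2]]]] /andP[_ /asboolP[y [Ay /andP[y1 y2]]]].
    have := hA x y Ax Ay; rewrite !ler_norml => /andP[? ?]; rewrite -/k'R in x2 y2.
    by apply/andP; split; lra.
  rewrite mulrDl.
  have : k'R^-1 / sg <= 1 by rewrite ler_pdivrMr // mul1r.
  lra.
(* With these weights the aim is a total below 1. A set at least as long as a child weighs 1, so it
   cannot meet the chosen child; a shorter one weighs its share [r^s] of the tolerated load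
   [c k'^(- s)]. *)
pose om n := if k'R^-1 <= r n then 1 else (r n * k'R) `^ s / c.
have c0 : 0 < c by rewrite divr_gt0.
have om0 n : 0 <= om n by rewrite /om; case: ifP => // _; rewrite divr_ge0 ?powR_ge0 // ltW.
(* The first term accounts for the at most 7 children met by a short set and for the constant 5 of a
   long one. The second accounts for [2 r / sg], through [r <= r^s k^(s - 1)], valid because
   [r <= 1 / k]. *)
pose Kc := 7 / c * k'R `^ s + 8 * b ^+ 2 * kR `^ s.
have ks0 : 0 < kR `^ s by exact: powR_gt0.
have Kc0 : 0 <= Kc.
  by rewrite addr_ge0 // mulr_ge0 ?powR_ge0 ?divr_ge0 ?mulr_ge0 ?(ltW c0) ?(ltW b20).
have hom n : \sum_(p in C) om n * touch (J p) n <= Kc * (touch (segment z k) n * r n `^ s).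
  have [tI|tI] := boolP (`[< exists x, F n x /\ segment z k x >]); last first.
    rewrite big1 ?mulr_ge0 ?touch_ge0 ?powR_ge0 // => p _.
    have := @touch_sub _ _ n (JI p); rewrite {2}/touch (negbTE tI) => h.
    have := touch_ge0 (J p) n => h'.
    have -> : touch (J p) n = 0 by apply/eqP; rewrite eq_le h h'.
    by rewrite mulr0.
  have tE : touch (segment z k) n = 1 by rewrite /touch tI.
  have rk : r n <= kR^-1.
    have : r n `^ s < c * kR `^ (- s).
      rewrite -lte_fin; case: hload => hload; apply: le_lt_trans hload.
      apply: le_trans (term_le_nneseries n _); last by move=> i; exact: load_term_ge0.
      by rewrite tE mul1r.
    move=> h; rewrite leNgt; apply/negP => h'.
    have : kR^-1 `^ s < r n `^ s by rewrite gt0_ltr_powR // nnegrE ?invr_ge0 ltW.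
    rewrite -powR_inv1 ?(ltW kR0) // -powRrM mulN1r => h''.
    have : c * kR `^ (- s) <= kR `^ (- s).
      by rewrite ler_piMl ?powR_ge0 // /c; lra.
    lra.
  rewrite tE mul1r -mulr_sumr.
  have cn := count (F n) (r n) (ltW (r0 n)) (@Fr n).
  set Sm := \sum_(p in C) touch (J p) n.
  have {}cn : Sm <= 5 + 2 * r n / sg by exact: cn.
  have rs0 : 0 < r n `^ s by exact: powR_gt0.
  have rr : r n <= r n `^ s * (kR `^ s / kR).
    have -> : kR `^ s / kR = (kR^-1) `^ (1 - s).
      have -> : kR^-1 `^ (1 - s) = kR `^ (s - 1).
        by rewrite -powR_inv1 ?(ltW kR0) // -powRrM mulN1r opprB.
      rewrite powRB; last by rewrite (gt_eqF kR0) implybT.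
      by rewrite (powRr1 (ltW kR0)).
    have {1}-> : r n = r n `^ s * r n `^ (1 - s).
      rewrite -powRD; last by rewrite (gt_eqF (r0 n)) implybT.
      by rewrite addrCA subrr addr0 powRr1 // ltW.
    rewrite ler_wpM2l ?(ltW rs0) // ge0_ler_powR ?nnegrE ?(ltW (r0 n)) ?invr_ge0 ?(ltW kR0) //; lra.
  have rsg : 2 * r n / sg <= 8 * b ^+ 2 * kR `^ s * r n `^ s.
    rewrite /sg invrK.
    apply: (@le_trans _ _ (2 * (r n `^ s * (kR `^ s / kR)) * (4 * b ^+ 2 * kR))).
      by rewrite ler_wpM2r ?mulr_ge0 ?(ltW b20) ?(ltW kR0) // ler_wpM2l.
    rewrite le_eqVlt; apply/orP; left; apply/eqP; field; exact: lt0r_neq0.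
  have rk's : (r n * k'R) `^ s = r n `^ s * k'R `^ s by rewrite powRM // ltW.
  have ks'0 : 0 < k'R `^ s by exact: powR_gt0.
  have prod0 : 0 < r n `^ s * k'R `^ s by exact: mulr_gt0.
  rewrite /om; case: ifP => [large|/negbT]; last rewrite -ltNge => small.
    rewrite mul1r; apply: le_trans cn _.
    have : 1 <= r n `^ s * k'R `^ s.
      rewrite -rk's -[leLHS](powRr0 (r n * k'R)) ler_powR ?(ltW s0) //.
      by rewrite -ler_pdivrMr // mul1r.
    rewrite /Kc /c; lra.
  have Sm7 : Sm <= 7.
    apply: le_trans cn _.
    have : r n / sg <= 1 by rewrite ler_pdivrMr // mul1r (le_trans (ltW small)).
    lra.
  apply: (@le_trans _ _ ((r n * k'R) `^ s / c * 7)).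
    by rewrite ler_wpM2l // divr_ge0 ?powR_ge0 // ltW.
  rewrite rk's /Kc mulrDl.
  have : 0 <= 8 * b ^+ 2 * kR `^ s * r n `^ s.
    by rewrite !mulr_ge0 ?(ltW b20) ?powR_ge0.
  rewrite /c; lra.
have final : Kc * (c * kR `^ (- s)) + 5 < #|C|%:R.
  have cp := coprime_pairs B; rewrite -/C in cp.
  have {}cp : b ^+ 2 <= 4 * #|C|%:R.
    by rewrite /b -natrX -natrM ler_nat.
  have -> : Kc * (c * kR `^ (- s)) = 7 * (k'R `^ s / kR `^ s) + b ^+ 2 / 8.
    rewrite /Kc /c powRN; field; exact: lt0r_neq0.
  have kk : k'R `^ s / kR `^ s <= k'R `^ s.
    rewrite ler_pdivrMr // ler_peMr ?powR_ge0 //.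
    by rewrite -[leLHS](powRr0 kR) ler_powR // ltW.
  have gam : 0 <= (1 + w) * s by rewrite mulr_ge0 ?(ltW s0) //; lra.
  have kE : k'R `^ s <= 2 * E * b `^ ((1 + w) * s).
    apply: (@le_trans _ _ ((2 * Y) `^ s)).
      by rewrite ge0_ler_powR ?nnegrE ?(ltW s0) ?(ltW k'0) //; lra.
    rewrite powRM ?(le_trans U0 UY) //.
    have -> : Y `^ s = E * b `^ ((1 + w) * s).
      rewrite /Y -powRrM /E -powRM ?mulr_ge0 //; try lra.
      by congr (_ `^ _); rewrite /U; ring.
    rewrite -mulrA ler_wpM2r ?mulr_ge0 ?powR_ge0 //.
    by rewrite ler1_powR ?ler1n // ltW.
  have bb : b `^ (2 - (1 + w) * s) * b `^ ((1 + w) * s) = b ^+ 2.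
    rewrite -powRD; last by rewrite (gt_eqF (lt_le_trans ltr01 b1)) implybT.
    by rewrite subrK powR_mulrn //; lra.
  have bg : 1 <= b `^ ((1 + w) * s) by rewrite -[leLHS](powRr0 b) ler_powR.
  have fin : 8 * (14 * E + 6) * b `^ ((1 + w) * s) <= b ^+ 2.
    by rewrite -bb ler_wpM2r // powR_ge0.
  move: (k'R `^ s / kR `^ s) (k'R `^ s) (b `^ ((1 + w) * s)) (b ^+ 2) kk kE fin bg cp => q K be b2.
  lra.
have kk' : (2 * k <= k')%N by rewrite -(ler_nat R) natrM -/kR -/k'R; lra.
have Up : 0 < U by lra.
have Yp : 0 < Y by lra.
have w0 : 0 <= 1 + w by lra.
(* The point [p0] enters the average as one more set, which meets at most 5 children. *)
pose pin p : R := (`[< J p p0 >])%:R.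
have [p pC hp] : exists2 p, p \in C &
    (\sum_(0 <= n <oo) (om n * touch (J p) n)%:E + (pin p)%:E < 1%:E)%E.
  apply: contrapT => no.
  have {}no p : p \in C ->
     (1%:E <= \sum_(0 <= n <oo) (om n * touch (J p) n)%:E + (pin p)%:E)%E.
    by move=> pC; rewrite leNgt; apply/negP => h; apply: no; exists p.
  have : (\sum_(p in C) 1%:E <= \sum_(p in C)
     (\sum_(0 <= n <oo) (om n * touch (J p) n)%:E + (pin p)%:E))%E.
    exact: lee_sum.
  rewrite sumEFin big_split /= -nneseries_sum; last first.
    by move=> p n _; rewrite lee_fin mulr_ge0 ?om0 ?touch_ge0.
  apply/negP; rewrite -ltNge.
  have h1 : (\sum_(0 <= n <oo) \sum_(p in C) (om n * touch (J p) n)%:E <=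
      Kc%:E * load (segment z k))%E.
    rewrite /load -nneseriesZl; last by move=> i _; exact: load_term_ge0.
    apply: lee_nneseries => n *.
      by apply: sume_ge0 => p _; rewrite lee_fin mulr_ge0 ?om0 ?touch_ge0.
    by rewrite -EFinM sumEFin lee_fin hom.
  have h2 : (\sum_(p in C) (pin p)%:E <= 5%:E)%E.
    rewrite sumEFin lee_fin.
    have := count [set p0] 0 (lexx 0); rewrite mulr0 mul0r addr0 => h.
    apply: le_trans (h _); last by move=> x y -> ->; rewrite subrr normr0.
    apply: ler_sum => p _; rewrite ler_nat.
    case: asboolP => // Jp; case: asboolP => // no'; exfalso; apply: no'; by exists p0.
  apply: le_lt_trans (leeD h1 h2) _.
  apply: (@le_lt_trans _ _ ((Kc * (c * kR `^ (- s)))%:E + 5%:E)%E).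
    by rewrite leeD2r // EFinM lee_wpmul2l ?lee_fin // ltW //; case: hload.
  by rewrite -EFinD lte_fin sumr_const.
have hp1 : (\sum_(0 <= n <oo) (om n * touch (J p) n)%:E < 1%:E)%E.
  by apply: le_lt_trans hp; rewrite leeDl // lee_fin ler0n.
have pos0 n : (0 <= (om n * touch (J p) n)%:E)%E by rewrite lee_fin mulr_ge0 ?om0 ?touch_ge0.
exists (child z k p), k'; split.
- exact: kk'.
- exact: JI.
- move=> Jp; have := le_lt_trans _ hp; move=> /(_ 1%:E); rewrite ltxx => h.
  suff : false by []; apply: h.
  rewrite /pin asboolT // -[leLHS]add0e leeD2r //; exact: nneseries_ge0.
- constructor; have ck : 0 < c * k'R `^ (- s) by rewrite mulr_gt0 ?powR_gt0.
  apply: (@le_lt_trans _ _ ((c * k'R `^ (- s))%:E *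
     \sum_(0 <= n <oo) (om n * touch (J p) n)%:E)%E); last first.
    by rewrite -[ltRHS]mule1 lte_pmul2l.
  rewrite -nneseriesZl //; apply: lee_nneseries => n *; first exact: load_term_ge0.
  rewrite -EFinM lee_fin -/(J p).
  have := le_lt_trans (term_le_nneseries n pos0) hp1; rewrite lte_fin.
  have [->|->] : touch (J p) n = 0 \/ touch (J p) n = 1.
    by rewrite /touch; case: asboolP; [right|left].
    by rewrite !mulr0 mul0r.
  rewrite mulr1 mul1r /om; case: ifP; first by rewrite ltxx.
  move=> _ _; rewrite powRM ?(ltW (r0 n)) ?(ltW k'0) // powRN.
  rewrite le_eqVlt; apply/orP; left; apply/eqP; field.
  by rewrite !gt_eqF // powR_gt0.
- apply: (@le_trans _ _ (U `^ (- (1 + w)))).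
    by rewrite powRN lef_pV2 ?posrE.
  have d0 : 0 < (denq (child z k p))%:~R :> R by rewrite ltr0z denq_gt0.
  rewrite !powRN lef_pV2 ?posrE ?powR_gt0 //.
  rewrite ge0_ler_powR ?nnegrE ?(ltW d0) ?(ltW Up) //.
  exact: denq_child_le.
Qed.

End Avoid.

(** Closeness below every [e] stands for infinitely many [z]. A rational [x] qualifies with [z = x],
    so irrationality is asked for separately where large denominators are wanted. *)
Definition approximable (R : realType) (w x : R) := forall e : R, 0 < e ->
  exists z : rat, `|x - ratr z| <= (denq z)%:~R `^ (- (1 + w)) /\ `|x - ratr z| < e.

(** Iterate [segment_refine] from [0, 1], excluding [pt n] at step [n]. The limit lies in no [F n]:
    such a set would touch every segment and contribute [r n ^ s] to loads below [k^(- s) / 64],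
    which tend to 0. *)
Lemma approximable_avoid (R : realType) (s w : R) (F : nat -> set R) (r pt : nat -> R) :
  0 < s -> s < 1 -> 1 <= w -> (1 + w) * s < 2 -> (forall n, 0 < r n) ->
  (forall n x y, F n x -> F n y -> `|x - y| <= r n) ->
  (\sum_(0 <= n <oo) (r n `^ s)%:E < (1 / 64)%:E)%E ->
  exists x, [/\ forall n, ~ F n x, forall n, x <> pt n & approximable w x].
Proof.
move=> s0 s1 w1 sw r0 Fr small.
have l0 : light s F r 0 1.
  constructor; rewrite powR1 mulr1; apply: le_lt_trans small.
  apply: lee_nneseries => n *; first exact: load_term_ge0.
  by rewrite lee_fin ler_piMl ?powR_ge0 // /touch lern1 leq_b1.
clear small.
pose T := {zk : rat * nat | (0 < zk.2)%N /\ light s F r zk.1 zk.2}.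
pose seg (t : T) : set R := segment (sval t).1 (sval t).2.
have step : forall tp : T * R, exists t' : T,
    [/\ (2 * (sval tp.1).2 <= (sval t').2)%N, seg t' `<=` seg tp.1, ~ seg t' tp.2 &
     (sval t').2%:R^-1 <= (denq (sval t').1)%:~R `^ (- (1 + w)) :> R].
  move=> [[[z k] [/= k0 zk]] p].
  have [z' [k' [h1 h2 h3 h4 h5]]] := segment_refine s0 s1 w1 sw r0 Fr p k0 zk.
  have k'0 : (0 < k')%N by apply: leq_trans h1; rewrite muln_gt0.
  by exists (exist _ (z', k') (conj k'0 h4)).
have [f hf] := choice step.
pose t0 : T := exist _ (0, 1%N) (conj (ltn0Sn 0) l0).
pose st := fix st n := if n is m.+1 then f (st m, pt m) else t0.
pose u n : R := ratr (sval (st n)).1.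
pose k n : nat := (sval (st n)).2.
have k0 n : (0 < k n)%N by exact: (svalP (st n)).1.
have kR n : 0 < (k n)%:R^-1 :> R by rewrite invr_gt0 ltr0n.
pose v n : R := u n + (k n)%:R^-1.
have segE n x : seg (st n) x <-> u n <= x <= v n by [].
have sub n : seg (st n.+1) `<=` seg (st n) by have [_ h _ _] := hf (st n, pt n).
have uv n : u n <= v n by rewrite lerDl ltW.
have hu n : u n <= u n.+1.
  by have /andP[] := sub n (u n.+1) (introT andP (conj (lexx _) (uv _))).
have hv n : v n.+1 <= v n.
  by have /andP[] := sub n (v n.+1) (introT andP (conj (uv _) (lexx _))).
have [x hx] := nested_intervals hu hv uv.
have k2 n : (n < k n)%N.
  elim: n => // n IH; have [h _ _ _] := hf (st n, pt n).
  by apply: leq_trans h; rewrite -/(k n); lia.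
have kn n : n%:R <= (k n)%:R :> R by rewrite ler_nat ltnW.
exists x; split.
- move=> n Fx.
  have rs : 0 < r n `^ s by exact: powR_gt0.
  have [N _ hN] := powR_unbounded (r n `^ s)^-1 s0.
  have [lt] := (svalP (st N)).2.
  have := le_lt_trans (term_le_nneseries n (load_term_ge0 s F r _)) lt.
  rewrite lte_fin (touch1 Fx (hx N)) mul1r -/(k N) powRN.
  have := hN _ (kn N); rewrite -ler_pV2 ?inE ?unitf_gt0 ?powR_gt0 ?invr_gt0 ?ltr0n // invrK => h.
  rewrite ltNge; move/negP; apply; apply: le_trans h.
  by rewrite ler_piMl ?invr_ge0 ?powR_ge0 //; lra.
- move=> n xn; have [_ _ h _] := hf (st n, pt n); apply: h.
  by move: (hx n.+1); rewrite /= xn.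
move=> e e0.
have [N _ hN] := powR_unbounded (e^-1 + 1) (@ltr01 R).
have [_ _ _ h] := hf (st N, pt N).
have /andP[x1 x2] := hx N.+1.
have d : `|x - u N.+1| <= (k N.+1)%:R^-1.
  by rewrite /v in x2; rewrite ler_norml; apply/andP; split; have := kR N.+1; lra.
exists (sval (st N.+1)).1; split; first exact: le_trans d h.
apply: le_lt_trans d _; rewrite -ltf_pV2 ?posrE // invrK.
have := hN (k N.+1)%:R; rewrite powRr1 // => h'.
apply: lt_le_trans (h' _); first by rewrite ltrDl.
by apply: le_trans (kn _); rewrite ler_nat.
Qed.

(** Measure zero would give a cover of total below 1/128. Projecting to coordinate [i] does not
    increase diameters, and [approximable_avoid] finds an [x] outside the projection, although the
    point of [A] above [x] is covered. *)
Lemma hmeasure_neq0 (R : realType) (d : nat) (i : 'I_d) (A : set 'rV[R]_d) (s w : R)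
    (T : countType) (pt : T -> R) :
  0 <= s -> 1 <= w -> (1 + w) * s < 2 ->
  (forall x, (forall t, x <> pt t) -> approximable w x -> exists2 a, A a & a ord0 i = x) ->
  hmeasure s A <> 0%E.
Proof.
move=> s0 w1 sw hA H0.
(* The avoidance needs a positive exponent, and [s] may be 0. The midpoint keeps [(1 + w) * s' < 2],
   and a larger exponent only lowers the powers of diameters at most 1. *)
pose s' := (s + 2 / (1 + w)) / 2.
have w0 : 0 < 1 + w by lra.
have sq : s < 2 / (1 + w) by rewrite ltr_pdivlMr // mulrC.
have q1 : 2 / (1 + w) <= 1 by rewrite ler_pdivrMr // mul1r; lra.
have s'0 : 0 < s' by rewrite /s'; lra.
have s's : s <= s' by rewrite /s'; lra.
have s'1 : s' < 1 by rewrite /s'; lra.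
have s'w : (1 + w) * s' < 2 by rewrite mulrC -ltr_pdivlMr // /s'; lra.
pose c : R := 1 / 128.
have c0 : 0 < c by rewrite /c; lra.
have [_ [F [FA Fd] <-] Fs] : exists2 y, [set (\sum_(0 <= n <oo) hcontrib s (F n))%E
            | F in [set F : nat -> set 'rV[R]_d |
                     A `<=` \bigcup_n F n /\ forall n, (ediam (F n) <= 1%:E)%E]] y & (y < c%:E)%E.
  apply: ereal_inf_lt; apply: (@le_lt_trans _ _ 0%E); last by rewrite lte_fin.
  rewrite -[leRHS]H0 -/(hcontent 1 s A).
  by apply: ereal_sup_ubound; exists 1 => //=; exact: ltr01.
pose dm n : R := if `[< F n = set0 >] then 0 else fine (ediam (F n)).
have dmP n x : F n x -> ediam (F n) = (dm n)%:E.
  move=> Fx; rewrite /dm asboolF; last by move=> F0; move: Fx; rewrite F0.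
  by have := Fd n; have := ediam_ge0 Fx; case: (ediam (F n)).
have dm0 n : 0 <= dm n.
  have [F0|/eqP/set0P[x Fx]] := pselect (F n = set0); first by rewrite /dm asboolT.
  by rewrite -lee_fin -(dmP n x Fx); exact: ediam_ge0 Fx.
have dm1 n : dm n <= 1.
  have [F0|/eqP/set0P[x Fx]] := pselect (F n = set0); first by rewrite /dm asboolT.
  by rewrite -lee_fin -(dmP n x Fx).
have dms n : ((dm n `^ s')%:E <= hcontrib s (F n))%E.
  rewrite /hcontrib /dm; case: asboolP => F0; first by rewrite powR0 // gt_eqF.
  rewrite lee_fin; have := dm0 n; have := dm1 n; rewrite /dm asboolF //.
  set a := fine _ => a1; rewrite le_eqVlt => /orP[/eqP <-|a0].
    by rewrite powR0 ?gt_eqF // powR_ge0.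
  by apply: ger_powR => //; rewrite a0.
(* Diameters may be 0 while positive radii are required; this padding adds at most [c] to the sum,
   and [c + c = 1 / 64]. *)
pose en n : R := (c / (2 ^ n.+1)%:R) `^ s'^-1.
have cn n : 0 < c / (2 ^ n.+1)%:R by rewrite divr_gt0 // ltr0n expn_gt0.
have en0 n : 0 < en n by exact: powR_gt0.
pose r n := Num.max (dm n) (en n).
have r0 n : 0 < r n by rewrite lt_max en0 orbT.
pose F' n : set R := [set a ord0 i | a in F n].
have Fr n x y : F' n x -> F' n y -> `|x - y| <= r n.
  move=> [a Fa <-] [b Fb <-]; apply: le_trans (coord_le_edist _ _ i) _.
  rewrite le_max; apply/orP; left.
  by rewrite -lee_fin -(dmP n a Fa); exact: edist_le_ediam.
have rs : (\sum_(0 <= n <oo) (r n `^ s')%:E < (1 / 64)%:E)%E.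
  apply: (@le_lt_trans _ _ (\sum_(0 <= n <oo) (hcontrib s (F n) + (c / (2 ^ n.+1)%:R)%:E))%E).
    apply: lee_nneseries => n *; first by rewrite lee_fin powR_ge0.
    rewrite /r; have [de|ed] := leP (dm n) (en n).
      rewrite /en -powRrM mulVf ?gt_eqF // powRr1 ?(ltW (cn n)) //.
      by rewrite leeDr // hcontrib_ge0.
    by apply: le_trans (dms n) _; rewrite leeDl // lee_fin ltW.
  apply: le_lt_trans (epsilon_trick _ (fun n => hcontrib_ge0 s (F n)) (ltW c0)) _.
  have -> : (1 / 64 = c + c :> R) by rewrite /c; field.
  by rewrite EFinD lteD2rE.
have [x [xF xp xa]] := approximable_avoid (fun n => if unpickle n is Some t then pt t else 0)
  s'0 s'1 w1 s'w r0 Fr rs.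
have [t|a Aa ax] := hA x _ xa.
  by move=> xt; apply: (xp (pickle t)); rewrite pickleK.
by have [n _ Fa] := FA a Aa; apply: (xF n); exists a.
Qed.

(** * The planar construction: rational lines, the hole, independence *)

Lemma approximable_denq (R : realType) (w x : R) (N : nat) : (forall q : rat, x <> ratr q) ->
  approximable w x -> exists z : rat, (N%:Z < denq z) /\ `|x - ratr z| <= (denq z)%:~R `^ (- (1 + w)).
Proof.
move=> irr hx.
have f0 : 0 < N`!%:R :> R by rewrite ltr0n fact_gt0.
(* Multiplied by [N!], a rational of denominator at most [N] becomes an integer, so it stays at
   distance at least [e / N!] from [x]. *)
have [|e e0 he] := @int_translate_gap R (N`!%:R * x).
  move=> n; apply/eqP => h; apply: (irr (- n%:~R / N`!%:R)).
  rewrite rmorphM /= fmorphV rmorphN /= ratr_int ratr_nat.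
  apply: (mulfI (lt0r_neq0 f0)); rewrite mulrCA mulfV ?gt_eqF // mulr1.
  by apply/eqP; rewrite -addr_eq0 addrC h.
have [z [z1 z2]] := hx (e / N`!%:R) (divr_gt0 e0 f0).
exists z; split => //; rewrite ltNge; apply/negP => dN.
have d0 := denq_gt0 z.
have dv : (`|denq z| %| N`!)%N by apply: dvdn_fact; lia.
pose M : int := numq z * (N`! %/ `|denq z|)%N%:Z.
have ME : N`!%:R * ratr z = M%:~R :> R.
  rewrite /M rmorphM /= -pmulrn -{1}(divnK dv) natrM.
  have -> : (`|denq z|%N%:R : R) = (denq z)%:~R by rewrite pmulrn gtz0_abs.
  have -> : (numq z)%:~R = ratr z * (denq z)%:~R :> R.
    by rewrite /ratr divfK // intr_eq0 denq_neq0.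
  ring.
have := he (- M); rewrite rmorphN /= -ME addrC -mulrBr normrM (gtr0_norm f0) => h.
move: z2; rewrite ltr_pdivlMr // mulrC => h2.
by have := le_lt_trans h h2; rewrite ltxx.
Qed.

(** The left side of the key equation minus [E] differs from [H / 4] by at most
    [H / 64 + H / 32 + H / 8 < H / 4], so [t * N] would lie strictly between 0 and [t]. *)
Lemma no_small_integer (R : realType) (H Sa t v1 v2 E : R) (N : int) :
  0 < H -> H <= t -> 0 <= Sa -> Sa <= 2 * H -> `|v1| < 1 / 64 -> `|v2 - 1 / 4| < 1 / 64 ->
  `|E| <= H / 8 -> H * v2 - Sa * v1 = E + t * N%:~R -> False.
Proof.
move=> H0 Ht Sa0 SaH h1 h2 hE key.
have sv : `|Sa * v1| <= H / 32.
  rewrite normrM (ger0_norm Sa0) [leRHS](_ : _ = 2 * H * (1 / 64)); last by field.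
  by apply: ler_pM => //; exact: ltW.
have hv : `|H * (v2 - 1 / 4)| <= H / 64.
  rewrite normrM (gtr0_norm H0) [leRHS](_ : _ = H * (1 / 64)); last by field.
  by rewrite ler_wpM2l ?(ltW H0) // ltW.
have {}key : t * N%:~R = H * (v2 - 1 / 4) + H / 4 - Sa * v1 - E.
  by rewrite [H * (v2 - _)]mulrBr; have := key; lra.
move: sv hv hE; rewrite !ler_norml => /andP[a1 a2] /andP[b1 b2] /andP[c1 c2].
have t0 : 0 < t by exact: lt_le_trans Ht.
have Nlo : 0 < t * N%:~R by lra.
have Nhi : t * N%:~R < t by lra.
move: Nlo Nhi; rewrite pmulr_rgt0 // ltr0z => N0.
by rewrite gtr_pMr // ltrz1 ltNge -gtz0_ge1 N0.
Qed.

(** For [t = |q|^eta] and [w0 = 1 / eta], the power [t^(1 + w0) = t |q|] is the factor that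
    magnifies the distance to a line. *)
Lemma power_error_le (R : realType) (H b w w0 t : R) : 0 < H -> 0 < b -> 0 < w0 -> 0 <= t ->
  t <= H * b -> 16 * H `^ w0 <= b `^ (w - w0) ->
  t `^ (1 + w0) * (2 * b `^ (- (1 + w))) <= H / 8.
Proof.
move=> H0 b0 w00 t0 tH hb.
have tH' : t `^ (1 + w0) <= H * H `^ w0 * b `^ (1 + w0).
  apply: (@le_trans _ _ ((H * b) `^ (1 + w0))).
    by rewrite ge0_ler_powR ?nnegrE ?mulr_ge0 ?(ltW H0) ?(ltW b0) //; lra.
  rewrite powRM ?(ltW H0) ?(ltW b0) // [H `^ (1 + w0)]powRD; last by rewrite (gt_eqF H0) implybT.
  by rewrite powRr1 // ltW.
apply: (@le_trans _ _ (H * H `^ w0 * b `^ (1 + w0) * (2 * b `^ (- (1 + w))))).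
  by rewrite ler_wpM2r // mulr_ge0 // powR_ge0.
have -> : b `^ (- (1 + w)) = b `^ (- (1 + w0)) / b `^ (w - w0).
  rewrite -powRB; last by rewrite (gt_eqF b0) implybT.
  by congr (_ `^ _); ring.
have bw : 0 < b `^ (w - w0) by exact: powR_gt0.
have bw' : 0 < b `^ (1 + w0) by exact: powR_gt0.
rewrite powRN [leLHS](_ : _ = H * (2 * H `^ w0 / b `^ (w - w0))); last first.
  by field; rewrite !gt_eqF.
rewrite ler_wpM2l ?(ltW H0) // ler_pdivrMr //; lra.
Qed.

(* The lines [H k * y = Sa k * x + Ta k] (cleared of denominators) through which the point
   [(x, Y)] is approached; line [k + 1] crosses line [k] above the convergent [z k] of [x]. *)
Record line_chain (R : realType) (w w0 x Y : R) (H b : nat -> nat) (z : nat -> rat)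
    (Sa Ta : nat -> int) : Prop := LineChain {
  chain_H0 : H 0%N = 1%N;
  chain_HS : forall k, H k.+1 = (H k * b k)%N;
  chain_bE : forall k, (b k)%:Z = denq (z k);
  chain_HHb : forall k, (H k * H k < b k)%N;
  chain_b2 : forall k, (2 <= b k)%N;
  chain_pow : forall k, 16 * (H k)%:R `^ w0 <= (b k)%:R `^ (w - w0) :> R;
  chain_z : forall k, `|x - ratr (z k)| <= (b k)%:R `^ (- (1 + w));
  chain_SaS : forall k, Sa k.+1 = (b k)%:Z * (Sa k + 1);
  chain_Sa0 : forall k, 0 <= Sa k;
  chain_SaH : forall k, Sa k <= 2 * (H k)%:Z - 2;
  chain_Y : forall k, `|(H k)%:R * Y - (Sa k)%:~R * x - (Ta k)%:~R| <= 2 * (b k)%:R `^ (- (1 + w))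
}.

Lemma next_convergent (R : realType) (w w0 x : R) (H : nat) : w0 < w ->
  (forall q : rat, x <> ratr q) -> approximable w x -> exists z : rat,
  [/\ (H * H)%:Z < denq z, 2 <= denq z, 16 * H%:R `^ w0 <= (denq z)%:~R `^ (w - w0) :> R &
      `|x - ratr z| <= (denq z)%:~R `^ (- (1 + w))].
Proof.
move=> w0w irr hx.
have g : 0 < w - w0 by rewrite subr_gt0.
have [N _ hN] := powR_unbounded (16 * H%:R `^ w0) g.
have [z [z1 z2]] := approximable_denq (N + H * H + 2) irr hx.
exists z; split => //; try lia.
by apply: hN; rewrite pmulrn ler_int; lia.
Qed.

(** [y k] is the partial sum over the common denominator [H k]. Its increments are bounded by
    [ep k], which at least halves at each step, so the intervals of radius [2 * ep k] around [y k]
    are nested and have a common point [Y]. *)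
Lemma line_chain_exists (R : realType) (w w0 x : R) : 0 < w0 -> w0 < w ->
  (forall q : rat, x <> ratr q) -> approximable w x ->
  exists Y H b z Sa Ta, line_chain w w0 x Y H b z Sa Ta.
Proof.
move=> w00 w0w irr hx.
have [g hg] := choice (fun H => @next_convergent R w w0 x H w0w irr hx).
pose bn H : nat := absz (denq (g H)).
have bnE H : (bn H)%:Z = denq (g H) by rewrite /bn gtz0_abs // denq_gt0.
pose H := fix H k := if k is k'.+1 then (H k' * bn (H k'))%N else 1%N.
pose b k := bn (H k).
pose z k := g (H k).
have HS k : H k.+1 = (H k * b k)%N by [].
have zP k : [/\ (H k * H k < b k)%N, (2 <= b k)%N,
    16 * (H k)%:R `^ w0 <= (b k)%:R `^ (w - w0) :> R &
    `|x - ratr (z k)| <= (b k)%:R `^ (- (1 + w))].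
  have [h1 h2 h3 h4] := hg (H k).
  have bE : (b k)%:R = (denq (g (H k)))%:~R :> R by rewrite -bnE pmulrn.
  rewrite bE; split => //; first by rewrite -ltz_nat bnE.
  by rewrite -lez_nat bnE.
have H0 k : (0 < H k)%N.
  by elim: k => // k IH; rewrite HS muln_gt0 IH /=; have [_ h _ _] := zP k; apply: leq_trans h.
have H2 k : (2 * H k <= H k.+1)%N.
  by rewrite HS mulnC leq_mul2l; have [_ -> _ _] := zP k; rewrite orbT.
have HR k : 0 < (H k)%:R :> R by rewrite ltr0n.
have b2 k : 2 <= (b k)%:R :> R by rewrite ler_nat; have [] := zP k.
have b0 k : 0 < (b k)%:R :> R by have := b2 k; lra.
pose Sa := fix Sa k : int := if k is k'.+1 then (b k')%:Z * (Sa k' + 1) else 0.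
pose Ta := fix Ta k : int := if k is k'.+1 then (b k')%:Z * Ta k' - numq (z k') else 0.
have SaS k : Sa k.+1 = (b k)%:Z * (Sa k + 1) by [].
have TaS k : Ta k.+1 = (b k)%:Z * Ta k - numq (z k) by [].
(* The slope [Sa k / H k] is the sum of [1 / H j] for [j < k]. The [- 2] strengthens [Sa <= 2 H]
   into a bound that the induction preserves, because [b k >= 2]. *)
have SaB k : 0 <= Sa k /\ Sa k <= 2 * (H k)%:Z - 2.
  elim: k => // k [IH1 IH2]; have [_ h _ _] := zP k.
  rewrite SaS; split; first by rewrite mulr_ge0 //; lia.
  rewrite HS PoszM; move: h IH2; move: (H k) (b k) (Sa k) => h' b' s' h IH2; nia.
pose y k : R := ((Sa k)%:~R * x + (Ta k)%:~R) / (H k)%:R.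
have yS k : y k.+1 = y k + (x - ratr (z k)) / (H k)%:R.
  rewrite /y HS natrM SaS TaS rmorphB !rmorphM rmorphD /= -pmulrn.
  have -> : (numq (z k))%:~R = ratr (z k) * (b k)%:R :> R.
    rewrite /b pmulrn bnE -/(z k) /ratr divfK // intr_eq0 denq_neq0 //.
  by field; rewrite !gt_eqF.
pose ep k : R := (b k)%:R `^ (- (1 + w)) / (H k)%:R.
have ep0 k : 0 < ep k by rewrite divr_gt0 ?powR_gt0.
have w1 : 0 < 1 + w by lra.
have epS k : 2 * ep k.+1 <= ep k.
  have bb : (b k)%:R `^ (1 + w) <= (b k.+1)%:R `^ (1 + w) :> R.
    rewrite ge0_ler_powR ?nnegrE ?(ltW w1) ?ler0n // ler_nat.
    have [h _ _ _] := zP k.+1; apply: leq_trans (ltnW h).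
    apply: (@leq_trans (H k.+1)); last by rewrite leq_pmull.
    by rewrite HS leq_pmull.
  have hh : 2 * (H k)%:R <= (H k.+1)%:R :> R by rewrite -natrM ler_nat.
  have hq : 2 / (H k.+1)%:R <= (H k)%:R^-1 :> R.
    by rewrite ler_pdivrMr // ler_pdivlMl // mulrC.
  rewrite /ep mulrCA; apply: ler_pM; [exact: powR_ge0|by rewrite divr_ge0| |exact: hq].
  by rewrite !powRN lef_pV2 ?posrE ?powR_gt0.
have dy k : `|y k.+1 - y k| <= ep k.
  rewrite yS addrC addKr normrM normfV (gtr0_norm (HR k)) ler_wpM2r ?invr_ge0 ?(ltW (HR k)) //.
  by have [] := zP k.
have [Y hY] : exists Y, forall k, y k - 2 * ep k <= Y <= y k + 2 * ep k.
  apply: nested_intervals => k.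
  - by have := dy k; have := epS k; rewrite ler_norml => ? /andP[? ?]; lra.
  - by have := dy k; have := epS k; rewrite ler_norml => ? /andP[? ?]; lra.
  - by have := ep0 k; lra.
have thP k : `|(H k)%:R * Y - (Sa k)%:~R * x - (Ta k)%:~R| <= 2 * (b k)%:R `^ (- (1 + w)).
  have -> : (H k)%:R * Y - (Sa k)%:~R * x - (Ta k)%:~R = (H k)%:R * (Y - y k).
    by rewrite /y; field; rewrite gt_eqF.
  rewrite normrM (gtr0_norm (HR k)) mulrC -ler_pdivlMr // -mulrA -/(ep k).
  by have /andP[? ?] := hY k; rewrite ler_norml; apply/andP; split; lra.
exists Y, H, b, z, Sa, Ta; split => // k; try by have [] := zP k.
- exact: bnE.
- by have [] := SaB k.
- by have [] := SaB k.
Qed.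

Section Chain.
Variables (R : realType) (w w0 x Y : R) (H b : nat -> nat) (z : nat -> rat) (Sa Ta : nat -> int).
Hypothesis C : line_chain w w0 x Y H b z Sa Ta.

Lemma chain_b_gt0 k : (0 < b k)%N.
Proof. exact: leq_trans (chain_b2 C k). Qed.

Lemma chain_H_gt0 k : (0 < H k)%N.
Proof.
elim: k => [|k IH]; first by rewrite (chain_H0 C).
by rewrite (chain_HS C) muln_gt0 IH chain_b_gt0.
Qed.

Lemma chain_H_double k : (2 * H k <= H k.+1)%N.
Proof. by rewrite (chain_HS C) mulnC leq_mul2l (chain_b2 C) orbT. Qed.

Lemma chain_ltn_H k : (k < H k)%N.
Proof.
elim: k => [|k IH]; first by rewrite (chain_H0 C).
apply: leq_trans (chain_H_double k); rewrite mul2n -addnn -addn1.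
by rewrite leq_add // chain_H_gt0.
Qed.

Let a : 'rV[R]_2 := \row_i (if i == ord0 then x else Y).

Lemma chain_hole (eta : R) : 0 < eta -> w0 = 1 / eta -> hole eta a.
Proof.
move=> eta0 w0E.
have w00 : 0 < w0 by rewrite w0E divr_gt0.
exists (\row_i (if i == ord0 then 0 else 1 / 4)), (1 / 64); split; first by rewrite divr_gt0.
move=> q p q0; apply: contrapT => no.
set t : R := (`|q|%:~R) `^ eta.
have h0 : `|t * (q%:~R * x - (p ord0 ord0)%:~R)| < 1 / 64.
  rewrite ltNge; apply/negP => h; apply: no; exists ord0.
  by rewrite !mxE eqxx subr0.
have h1 : `|t * (q%:~R * Y - (p ord0 (lift ord0 ord0))%:~R) - 1 / 4| < 1 / 64.
  rewrite ltNge; apply/negP => h; apply: no; exists (lift ord0 ord0).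
  by rewrite !mxE.
have qR : 1 <= `|q|%:~R :> R by rewrite ler1z -gtz0_ge1 normr_gt0.
have t1 : 1 <= t by rewrite -[leLHS](powRr0 (`|q|%:~R)) ler_powR // ltW.
(* The first such index is [k + 1], so [H k <= t < H k * b k]: the lower bound serves the
   integrality argument, the upper one keeps the error of line [k] small. *)
have ex : exists j, t < (H j)%:R.
  exists (Num.truncn t).+1; apply: lt_trans (truncnS_gt t) _.
  by rewrite ltr_nat chain_ltn_H.
case: (ex_minnP ex) => -[|k] tk minj; first by move: tk; rewrite (chain_H0 C) ltNge t1.
have kt : (H k)%:R <= t.
  by rewrite leNgt; apply/negP => /minj; rewrite ltnn.
pose N : int := q * Ta k - (H k)%:Z * p ord0 (lift ord0 ord0) + Sa k * p ord0 ord0.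
have HR : 0 < (H k)%:R :> R by rewrite ltr0n chain_H_gt0.
have bR : 0 < (b k)%:R :> R by rewrite ltr0n chain_b_gt0.
have tge0 : 0 <= t by exact: le_trans t1.
apply: (@no_small_integer R (H k)%:R (Sa k)%:~R t _ _
  (t * q%:~R * ((H k)%:R * Y - (Sa k)%:~R * x - (Ta k)%:~R)) N HR kt _ _ h0 h1).
- by rewrite ler0z (chain_Sa0 C).
- have : (Sa k)%:~R <= (2 * (H k)%:Z)%:~R :> R.
    by rewrite ler_int; apply: le_trans (chain_SaH C k) _; rewrite gerBl.
  by rewrite rmorphM /= -pmulrn.
- have tq : `|t * q%:~R| = t `^ (1 + w0).
    rewrite normrM (ger0_norm tge0) -intr_norm.
    rewrite powRD; last by rewrite (gt_eqF (lt_le_trans ltr01 t1)) implybT.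
    rewrite powRr1 //; congr (_ * _).
    by rewrite /t -powRrM w0E mul1r mulfV ?gt_eqF // powRr1 // (le_trans ler01 qR).
  rewrite normrM tq.
  apply: le_trans (power_error_le HR bR w00 tge0 _ (chain_pow C k)).
    by rewrite ler_wpM2l ?powR_ge0 // (chain_Y C).
  by move: tk; rewrite (chain_HS C) natrM => /ltW.
- rewrite /N rmorphD rmorphB !rmorphM /= -pmulrn; ring.
Qed.

(** Replacing [Y] by line [k] leaves [A + B x] nearly 0; replacing [x] by [z k] and clearing [b k]
    gives an integer [W] with [|W| < 1]. So [W = 0], and [b k], coprime to the numerator of [z k],
    divides [B]; but [|B| <= (H k)^2 < b k]. *)
Lemma chain_coef_eq0 (e0 e1 e2 : int) k : 1 <= w -> e0%:~R + e1%:~R * x + e2%:~R * Y = 0 ->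
  `|e1| + 4 * `|e2| <= (H k)%:Z -> (H k)%:Z * e1 + e2 * Sa k = 0.
Proof.
move=> w1 he EH; set B : int := _ + _.
pose A : int := (H k)%:Z * e0 + e2 * Ta k.
pose W : int := A * (b k)%:Z + B * numq (z k).
have Sa0 := chain_Sa0 C k.
have h1Z : 1 <= (H k)%:Z by rewrite lez_nat chain_H_gt0.
have SaH : Sa k <= 2 * (H k)%:Z.
  by apply: le_trans (chain_SaH C k) _; rewrite gerBl.
have BH : `|B| + 2 * `|e2| < (b k)%:Z.
  have hb : (H k)%:Z * (H k)%:Z < (b k)%:Z by rewrite -PoszM ltz_nat (chain_HHb C).
  apply: le_lt_trans hb; apply: (@le_trans _ _ ((H k)%:Z * (`|e1| + 4 * `|e2|))); last first.
    by rewrite ler_wpM2l.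
  have B1 : `|B| <= (H k)%:Z * `|e1| + `|e2| * (2 * (H k)%:Z).
    apply: le_trans (ler_normD _ _) _; rewrite !normrM.
    by rewrite (ger0_norm Sa0) (@ger0_norm _ (H k)%:Z) // lerD2l ler_wpM2l.
  apply: le_trans (lerD B1 (lexx _)) _.
  have : 2 * `|e2| * 1 <= 2 * `|e2| * (H k)%:Z by rewrite ler_wpM2l // mulr_ge0.
  move: (H k)%:Z `|e1| `|e2| => h n1 n2 h3; lra.
have bR : 0 < (b k)%:R :> R by rewrite ltr0n chain_b_gt0.
have b2 : 2 <= (b k)%:R :> R by rewrite ler_nat (chain_b2 C).
have AB : `|A%:~R + B%:~R * x| <= 2 * `|e2|%:~R * (b k)%:R `^ (- (1 + w)).
  have -> : A%:~R + B%:~R * x = - (e2%:~R * ((H k)%:R * Y - (Sa k)%:~R * x - (Ta k)%:~R)).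
    rewrite /A /B !rmorphD !rmorphM /= -pmulrn.
    have -> : e2%:~R * ((H k)%:R * Y - (Sa k)%:~R * x - (Ta k)%:~R) =
      (H k)%:R * (e0%:~R + e1%:~R * x + e2%:~R * Y) - (H k)%:R * (e0%:~R + e1%:~R * x)
       - e2%:~R * ((Sa k)%:~R * x + (Ta k)%:~R) by ring.
    by rewrite he; ring.
  rewrite normrN normrM -intr_norm [2 * _]mulrC -mulrA ler_wpM2l ?ler0z //.
  exact: (chain_Y C).
have cE : (`|B| + 2 * `|e2|)%:~R = `|B|%:~R + 2 * `|e2|%:~R :> R.
  by rewrite [LHS]rmorphD [X in _ + X = _]rmorphM.
have numE : (numq (z k))%:~R = ratr (z k) * (b k)%:R :> R.
  by rewrite pmulrn (chain_bE C) /ratr divfK // intr_eq0 denq_neq0.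
have W0 : W = 0.
  apply/eqP; apply: contraT => Wn.
  have W1 : 1 <= `|W%:~R| :> R by rewrite -intr_norm ler1z -gtz0_ge1 normr_gt0.
  have WE : W%:~R = ((A%:~R + B%:~R * x) - B%:~R * (x - ratr (z k))) * (b k)%:R :> R.
    by rewrite /W rmorphD !rmorphM /= -pmulrn numE; ring.
  have P0 : 0 < (b k)%:R `^ (1 + w) :> R by exact: powR_gt0.
  have h1 : `|W%:~R| <= (`|B| + 2 * `|e2|)%:~R * (b k)%:R `^ (- (1 + w)) * (b k)%:R :> R.
    rewrite WE normrM (gtr0_norm bR) ler_wpM2r ?(ltW bR) //.
    apply: le_trans (ler_normB _ _) _; rewrite cE [leRHS]mulrDl [leLHS]addrC.
    apply: lerD => //; rewrite normrM -intr_norm ler_wpM2l ?ler0z //; exact: (chain_z C).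
  have h2 : (`|B| + 2 * `|e2|)%:~R < (b k)%:R :> R by rewrite [(b k)%:R]pmulrn ltr_int.
  have h3 : (b k)%:R * (b k)%:R <= (b k)%:R `^ (1 + w) :> R.
    rewrite -expr2 -powR_mulrn ?ler0n // ler_powR; first by [].
      by apply: le_trans b2; rewrite ler1n.
    by rewrite -[2%:R]/(1 + 1) lerD2l.
  have : (1 : R) < 1.
    apply: le_lt_trans W1 _; apply: le_lt_trans h1 _.
    rewrite powRN mulrAC ltr_pdivrMr // mul1r; apply: lt_le_trans h3.
    by rewrite ltr_pM2r.
  by rewrite ltxx.
have dvd : (b k %| absz B)%N.
  have h : A * (b k)%:Z = - (B * numq (z k)) by apply/eqP; rewrite -addr_eq0; apply/eqP.
  have cop : coprime (b k) (absz (numq (z k))).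
    rewrite coprime_sym; have := coprime_num_den (z k).
    by rewrite -(chain_bE C).
  rewrite -(Gauss_dvdl _ cop) -abszM.
  have -> : B * numq (z k) = - (A * (b k)%:Z) by rewrite h opprK.
  by rewrite abszN abszM dvdn_mull.
apply/eqP; apply: contraT => Bn.
have := dvdn_leq _ dvd; rewrite absz_gt0 => /(_ Bn); rewrite -lez_nat abszE leNgt => /negP; case.
by apply: le_lt_trans BH; rewrite lerDl mulr_ge0.
Qed.

(** The numbers [B k = H k * e1 + e2 * Sa k] satisfy [B (k+1) = b k * (B k + e2)], as the slope
    changes from line to line. Two consecutive zeros give [e2 = 0]. *)
Lemma chain_int_independent (e0 e1 e2 : int) : 1 <= w ->
  e0%:~R + e1%:~R * x + e2%:~R * Y = 0 -> [/\ e0 = 0, e1 = 0 & e2 = 0].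
Proof.
move=> w1 he; pose E := (absz e1 + 4 * absz e2)%N.
have EE k : (E <= k)%N -> `|e1| + 4 * `|e2| <= (H k)%:Z.
  move=> Ek; have -> : `|e1| + 4 * `|e2| = E%:Z by rewrite /E PoszD PoszM !abszE.
  by rewrite lez_nat (leq_trans Ek) // ltnW // chain_ltn_H.
have B1 := chain_coef_eq0 w1 he (EE E (leqnn _)).
have B2 := chain_coef_eq0 w1 he (EE E.+1 (leqnSn _)).
have e20 : e2 = 0.
  have : (H E.+1)%:Z * e1 + e2 * Sa E.+1 = (b E)%:Z * (((H E)%:Z * e1 + e2 * Sa E) + e2).
    by rewrite (chain_HS C) (chain_SaS C) PoszM; ring.
  rewrite B1 B2 add0r => /esym/eqP; rewrite mulf_eq0 => /orP[|/eqP //].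
  by rewrite eqz_nat eqn0Ngt chain_b_gt0.
have e10 : e1 = 0.
  move: B1; rewrite e20 mul0r addr0 => /eqP; rewrite mulf_eq0 => /orP[|/eqP //].
  by rewrite eqz_nat eqn0Ngt chain_H_gt0.
split => //.
by move: he; rewrite e10 e20 !mul0r !addr0 => /eqP; rewrite intr_eq0 => /eqP.
Qed.

Lemma chain_Kset : 1 <= w -> Kset a.
Proof.
move=> w1 c0 c.
have -> : \sum_(i < 2) ratr (c i) * a ord0 i = ratr (c ord0) * x + ratr (c (lift ord0 ord0)) * Y.
  by rewrite big_ord_recl big_ord1 !mxE.
set c1 := c ord0; set c2 := c (lift ord0 ord0) => hc.
pose e0 : int := numq c0 * denq c1 * denq c2.
pose e1 : int := numq c1 * denq c0 * denq c2.
pose e2 : int := numq c2 * denq c0 * denq c1.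
have he : e0%:~R + e1%:~R * x + e2%:~R * Y = 0.
  have nE (q : rat) : (numq q)%:~R = ratr q * (denq q)%:~R :> R.
    by rewrite /ratr divfK // intr_eq0 denq_neq0.
  have -> : e0%:~R + e1%:~R * x + e2%:~R * Y = (ratr c0 + (ratr c1 * x + ratr c2 * Y)) *
     ((denq c0)%:~R * (denq c1)%:~R * (denq c2)%:~R).
    by rewrite /e0 /e1 /e2 !rmorphM /= !nE; ring.
  by rewrite hc mul0r.
have [e00 e10 e20] := chain_int_independent w1 he.
have num0 (q : rat) (m n : int) : m != 0 -> n != 0 -> numq q * m * n = 0 -> q = 0.
  move=> m0 n0 /eqP; rewrite !mulf_eq0 (negbTE m0) (negbTE n0) !orbF numq_eq0.
  by move/eqP.
split; first exact: num0 (denq_neq0 _) (denq_neq0 _) e00.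
move=> i; have [->|i0] := eqVneq i ord0; first exact: num0 (denq_neq0 _) (denq_neq0 _) e10.
have -> : i = lift ord0 ord0.
  by apply/val_inj; case: i i0 => -[|[|]].
exact: num0 (denq_neq0 _) (denq_neq0 _) e20.
Qed.

End Chain.

Lemma planar_exceptional (R : realType) (eta w x : R) : 0 < eta -> 1 / eta < w -> 1 <= w ->
  (forall q : rat, x <> ratr q) -> approximable w x ->
  exists2 a : 'rV[R]_2, hole eta a /\ Kset a & a ord0 ord0 = x.
Proof.
move=> eta0 etaw w1 irr hx.
have w00 : 0 < 1 / eta by rewrite divr_gt0.
have [Y [H [b [z [Sa [Ta C]]]]]] := line_chain_exists w00 etaw irr hx.
exists (\row_i (if i == ord0 then x else Y)); last by rewrite mxE.
by split; [exact: chain_hole C _ eta0 erefl|exact: chain_Kset C w1].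
Qed.

(** * Adding coordinates *)

Section Extension.
Variables (R : realType) (d : nat).

Definition extend (a : 'rV[R]_d) (t : R) : 'rV[R]_d.+1 :=
  \row_i (if unlift ord_max i is Some j then a ord0 j else t).

Lemma extend_lift a t j : extend a t ord0 (lift ord_max j) = a ord0 j.
Proof. by rewrite mxE liftK. Qed.

Lemma extend_max a t : extend a t ord0 ord_max = t.
Proof. by rewrite mxE unlift_none. Qed.

Lemma hole_extend eta a t : hole eta a -> hole eta (extend a t).
Proof.
move=> [y [e [e0 h]]]; exists (extend y 0), e; split => // q p q0.
have [i hi] := h q (\row_j p ord0 (lift ord_max j)) q0.
by exists (lift ord_max i); rewrite !extend_lift; move: hi; rewrite mxE.
Qed.

(** A relation with nonzero coefficient at [t] would make [t] one of the countably many rational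
    affine combinations of the coordinates of [a]. *)
Lemma Kset_extend a t : Kset a ->
  (forall c : rat * {ffun 'I_d -> rat}, t <> ratr c.1 + \sum_j ratr (c.2 j) * a ord0 j) ->
  Kset (extend a t).
Proof.
move=> aK ht c0 c; rewrite (bigD1_ord ord_max) //= extend_max.
under eq_bigr do rewrite extend_lift.
move=> h; have cm : c ord_max = 0.
  apply/eqP; apply: contraT => cm; exfalso.
  have cm' : ratr (c ord_max) != 0 :> R by rewrite fmorph_eq0.
  apply: (ht (- c0 / c ord_max, [ffun j => - c (lift ord_max j) / c ord_max])) => /=.
  apply: (mulfI cm'); rewrite mulrDr mulr_sumr.
  under eq_bigr do rewrite ffunE rmorphM fmorphV rmorphN /= mulrA [X in X * _]mulrC divfK // mulNr.
  rewrite rmorphM fmorphV rmorphN /= mulrC [X in _ = X + _]mulrC divfK // sumrN -opprD.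
  by apply/eqP; rewrite -addr_eq0 mulrC; apply/eqP; rewrite -[RHS]h; ring.
have [|-> hc] := aK c0 (fun j => c (lift ord_max j)).
  by move: h; rewrite cm rmorph0 mul0r add0r.
split => // i; have [j ->|->] := unliftP ord_max i; first exact: hc.
exact: cm.
Qed.

End Extension.

Lemma hmeasure_set0 (R : realType) (d : nat) (s : R) : 0 <= s -> hmeasure s (@set0 'rV[R]_d) = 0%E.
Proof.
move=> s0.
apply: (@limsup_hmeasure0 _ _ s set0 (fun=> void) (fun _ _ => set0) (fun=> 0)) => //.
move=> e e0; exists 0%N; split => [k _|N]; first exact: ltW.
by rewrite big1 ?(ltW e0) // => k _; rewrite card_void mul0r.
Qed.

(** * Lower bound for the dimension *)

Section Lower.
Variables (R : realType) (eta : R).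

Definition exceptional (d : nat) : set 'rV[R]_d := ~` (@Dset R d eta) `&` @Kset R d.

Lemma exceptional2_hmeasure_neq0 (s : R) : 0 < eta -> eta < 1 / 2 -> 0 <= s ->
  s * (1 + 1 / eta) < 2 -> hmeasure s (exceptional (d := 2)) <> 0%E.
Proof.
move=> eta0 eta2 s0 hs.
have w02 : 2 < 1 / eta by rewrite ltr_pdivlMr // mulrC -ltr_pdivlMr.
(* Chosen so that [s * g] uses at most half of the gap [2 - s (1 + 1 / eta)]; the [+ 1] in the
   denominator allows [s = 0]. *)
pose g := (2 - s * (1 + 1 / eta)) / (2 * (s + 1)).
have g0 : 0 < g by rewrite divr_gt0 ?subr_gt0 // mulr_gt0 //; lra.
apply: (@hmeasure_neq0 R 2 ord0 _ s (1 / eta + g) rat (fun q => ratr q)) => //.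
- lra.
- have -> : (1 + (1 / eta + g)) * s = s * (1 + 1 / eta) + s * g by ring.
  have sg : s * g <= (2 - s * (1 + 1 / eta)) / 2.
    rewrite /g mulrA ler_pdivrMr; last by rewrite mulr_gt0 //; lra.
    rewrite [leRHS](_ : _ = (2 - s * (1 + 1 / eta)) * (s + 1)); last by field; rewrite gt_eqF.
    by rewrite mulrC ler_wpM2l; lra.
  apply: le_lt_trans (lerD (lexx _) sg) _; lra.
move=> x irr hx.
have [||a [aH aK] ax] := @planar_exceptional R eta (1 / eta + g) x eta0 _ _ irr hx; try lra.
by exists a => //; split => //; exact: hole_notin_Dset.
Qed.

Lemma exceptional_extend (d : nat) (a : 'rV[R]_d) (t : R) : (0 < d)%N -> exceptional a ->
  (forall c : rat * {ffun 'I_d -> rat}, t <> ratr c.1 + \sum_j ratr (c.2 j) * a ord0 j) ->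
  exceptional (extend a t).
Proof.
move=> d0 [aD aK] ht; split; last exact: Kset_extend.
by apply: hole_notin_Dset; apply: hole_extend; exact: notin_Dset_hole.
Qed.

(** Over one fixed exceptional [a], all but countably many last coordinates are allowed. With
    [w = 1] the condition of [hmeasure_neq0] becomes [s < 1]. *)
Lemma exceptional_extend_hmeasure_neq0 (d : nat) (s : R) : (0 < d)%N -> exceptional (d := d) !=set0 ->
  0 <= s -> s < 1 -> hmeasure s (exceptional (d := d.+1)) <> 0%E.
Proof.
move=> d0 [a aE] s0 s1.
apply: (@hmeasure_neq0 R d.+1 ord_max _ s 1 _
  (fun c : rat * {ffun 'I_d -> rat} => ratr c.1 + \sum_j ratr (c.2 j) * a ord0 j)) => //.
  lra.
move=> t ht _; exists (extend a t); last exact: extend_max.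
exact: exceptional_extend.
Qed.

(** At [s = 0] the empty set has measure zero, so nonvanishing yields a point, over which the next
    dimension is built. *)
Lemma exceptional_nonempty (d : nat) : 0 < eta -> eta < 1 / 2 -> (2 <= d)%N ->
  exceptional (d := d) !=set0.
Proof.
move=> eta0 eta2; elim: d => // d IH; rewrite leq_eqVlt => /orP[/eqP <-|].
  apply/set0P; apply/eqP => E0.
  apply: (exceptional2_hmeasure_neq0 eta0 eta2 (lexx 0)); first by rewrite mul0r.
  by rewrite E0 hmeasure_set0.
rewrite ltnS => d2; apply/set0P; apply/eqP => E0.
apply: (exceptional_extend_hmeasure_neq0 (ltnW d2) (IH d2) (lexx 0) ltr01).
by rewrite E0 hmeasure_set0.
Qed.

Lemma hdim_exceptional_ge (d : nat) : 0 < eta -> eta < 1 / d%:R -> (2 <= d)%N ->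
  ((d%:R / (1 + 1 / eta))%:E <= hdim (exceptional (d := d)))%E.
Proof.
move=> eta0 etad d2.
have dR : 2 <= d%:R :> R by rewrite ler_nat.
have eta2 : eta < 1 / 2.
  by apply: lt_le_trans etad _; rewrite !mul1r lef_pV2 ?posrE //; lra.
have q0 : 0 < 1 + 1 / eta by rewrite addr_gt0 // divr_gt0.
apply: le_ereal_inf_tmp => _ [s [s0 hs] <-]; rewrite lee_fin leNgt; apply/negP => sd.
case: d d2 dR etad sd hs => // d d2 dR etad sd.
move: d2; rewrite leq_eqVlt => /orP[/eqP dE|].
  move: sd; rewrite -dE ltr_pdivlMr //; exact: exceptional2_hmeasure_neq0.
rewrite ltnS => d2.
apply: exceptional_extend_hmeasure_neq0 => //; first exact: ltnW.
  exact: exceptional_nonempty.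
(* As [1 / eta] exceeds the dimension, the claimed bound is below 1, the range reached by varying
   the last coordinate alone. *)
apply: lt_le_trans sd _; rewrite ler_pdivrMr // mul1r.
have h : d.+1%:R < 1 / eta.
  by rewrite ltr_pdivlMr // mulrC -ltr_pdivlMr //; lra.
by lra.
Qed.

End Lower.

Theorem theorem2 (R : realType) (d : nat) (eta : R) :
  0 < eta -> eta < 1 / d%:R ->
  ((d = 1%N ->
     ~` (@Dset R 1 eta) = ~` (@Kset R 1) /\ ~` (@Kset R 1) = @Qset1 R) /\
   ((2 <= d)%N ->
     ((d%:R / (1 + 1 / eta))%:E <= hdim (~` (@Dset R d eta) `&` @Kset R d))%E /\
     (hdim (~` (@Dset R d eta) `&` @Kset R d) <=
        (d%:R - 2 + (2 * (d%:R + 1) * ((1 + eta) * d%:R - 1))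
                    / ((1 + eta) * d%:R ^+ 2))%:E)%E)).
Proof.
move=> eta0 etad; split => [d1|d2]; last first.
  by split; [exact: hdim_exceptional_ge|exact: hdim_exceptional_le].
have eta1 : eta < 1 by move: etad; rewrite d1 divr1.
have KQ : ~` (@Kset R 1) = @Qset1 R by apply/seteqP; split => a /notin_Kset1.
split => //; rewrite KQ; apply/seteqP; split => a.
  by move=> /(notin_Dset_hole (ltn0Sn 0)); exact: hole1_rational.
by move=> /(rational_hole eta0)/hole_notin_Dset.
Qed.
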